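(* Assume $\mathfrak{b}=\mathfrak{c}$. Let $\alpha<\omega_1$. If $\{\alpha_n:n\in\omega\}\subseteq\alpha$ (i.e. each $\alpha_n$ is an ordinal $<\alpha$), then there exists a topological space that is $\alpha_n$-sequentially compact for all $n\in\omega$ but fails to be $\alpha$-sequentially compact. In particular, for every $\alpha<\beta<\omega_1$ there exists an $\alpha$-sequentially compact space that is not $\beta$-sequentially compact.
   Context: $\mathfrak{b}$ is the bounding number (least size of a $\leq^*$-unbounded family in $\omega^\omega$) and $\mathfrak{c}=2^{\aleph_0}$. For sets of naturals, $s\sqsubseteq t$ means $s$ is an initial segment of $t$. For $\mathcal{F}\subseteq[\omega]^{<\omega}$ and $M\subseteq\omega$ let $\mathcal{F}|M=\{s\in\mathcal{F}:s\subseteq M\}$. A barrier on an infinite set $M\subseteq\omega$ is a family $\mathcal{B}$ of finite subsets of $M$ such that (a) $s\subseteq t$ implies $s=t$ for $s,t\in\mathcal{B}$, and (b) every infinite $N\subseteq M$ has an initial segment $s\sqsubseteq N$ with $s\in\mathcal{B}$. Rank: $T(\mathcal{B})=\{s\in[\omega]^{<\omega}:\exists t\in\mathcal{B}\,(s\sqsubseteq t)\}$, $\rho_{T(\mathcal{B})}(s)=\sup\{\rho_{T(\mathcal{B})}(t)+1:t\in T(\mathcal{B}),\ s\sqsubseteq t,\ s\neq t\}$ (with $\sup\emptyset=0$), and $\rho(\mathcal{B})=\rho_{T(\mathcal{B})}(\emptyset)<\omega_1$. Sequential compactness: if $\mathcal{B}$ is a barrier on an infinite set $M$, $f:\mathcal{B}\to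 X$ converges to $x\in X$ if for every open $U\ni x$ there is $n\in\omega$ with $f[\mathcal{B}|(M\setminus n)]\subseteq U$. For a barrier $\mathcal{B}$ on $\omega$, $X$ is $\mathcal{B}$-sequentially compact if for every $f:\mathcal{B}\to X$ there is an infinite $M\subseteq\omega$ such that $f\restriction(\mathcal{B}|M)$ converges to some point of $X$. For $\alpha<\omega_1$, $X$ is $\alpha$-sequentially compact if it is $\mathcal{B}$-sequentially compact for all barriers $\mathcal{B}$ on $\omega$ of rank $\alpha$. *)

(* Defs.v *)
From HB Require Import structures.
From mathcomp Require Import all_boot all_order finmap.
From mathcomp Require Import boolp classical_sets functions cardinality wochoice.
From mathcomp Require Import filter topology.

Set Implicit Arguments.
Unset Strict Implicit.
Unset Printing Implicit Defensive.

Import Order.TTheory.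
Local Open Scope classical_set_scope.
Local Open Scope card_scope.

(** ** The ordinal omega_1 *)

(* A well-order of the (uncountable) type [set nat], restricted to the points
   with countably many predecessors: by [omega1_min], [omega1_lt_countable] and
   [omega1_uncountable] below, it is an uncountable well-ordered set whose
   proper initial segments are countable, so its order type is omega_1.
   The countable ordinals are therefore exactly the elements of [omega1]. *)

Definition wo_le : rel (set nat) :=
  sval (well_ordering_principle (set nat)).

Definition omega1 : Type :=
  {x : set nat | `[< countable [set y | wo_le y x] >]}.

Definition omega1_disp : Order.disp_t. Proof. exact: Order.Disp tt tt. Qed.

HB.instance Definition _ := [Choice of omega1 by <:].

Definition omega1_le : rel omega1 := fun x y => wo_le (val x) (val y).

Lemma wo_leP : well_order wo_le.
Proof. exact: (svalP (well_ordering_principle (set nat))). Qed.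

Lemma wo_le_chain : wo_chain wo_le predT.
Proof. by move=> A _; exact: wo_leP. Qed.

Lemma wo_le_refl : reflexive wo_le.
Proof. by move=> x; exact: (wo_chain_reflexive wo_le_chain). Qed.

Lemma wo_le_total : total wo_le.
Proof. by move=> x y; exact: (wo_chainW wo_le_chain). Qed.

Lemma wo_le_anti : antisymmetric wo_le.
Proof. by move=> x y; exact: (wo_chain_antisymmetric wo_le_chain). Qed.

Lemma wo_le_min (A : set (set nat)) : A !=set0 ->
  exists2 x, A x & forall y, A y -> wo_le x y.
Proof.
move=> [a Aa]; have [|x [[Ax xmin] _]] := wo_leP (A := [pred x | `[< A x >]]).
  by exists a; apply/asboolP.
exists x; first exact: (asboolW Ax).
by move=> y Ay; apply: xmin; apply/asboolP.
Qed.

Lemma wo_le_trans : transitive wo_le.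
Proof.
move=> y x z xy yz.
have [|m mA mmin] := @wo_le_min [set x; y; z]; first by exists x; left; left.
have mx := mmin x (or_introl (or_introl erefl)).
have my := mmin y (or_introl (or_intror erefl)).
have mz := mmin z (or_intror erefl).
case: mA => [[|]|] /= E; rewrite {}E in mx my mz.
- by [].
- by rewrite (wo_le_anti (introT andP (conj xy mx))).
- by rewrite -(wo_le_anti (introT andP (conj yz my))).
Qed.

Lemma omega1_le_anti : antisymmetric omega1_le.
Proof. by move=> x y /wo_le_anti/val_inj. Qed.

Lemma omega1_le_trans : transitive omega1_le.
Proof. by move=> y x z; exact: wo_le_trans. Qed.

Lemma omega1_le_total : total omega1_le.
Proof. by move=> x y; exact: wo_le_total. Qed.

HB.instance Definition _ := @Order.isOrder.Build omega1_disp omega1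
  omega1_le _ _ _ (fun _ _ => erefl) (fun _ _ => erefl) (fun _ _ => erefl)
  omega1_le_anti omega1_le_trans omega1_le_total.

Lemma omega1_min (A : set omega1) : A !=set0 ->
  exists2 x, A x & lbound A x.
Proof.
move=> [a Aa]; have [|_ [x Ax <-] xmin] := @wo_le_min (val @` A).
  by exists (val a), a.
by exists x => // y Ay; apply: xmin; exists y.
Qed.

Lemma omega1_lt_countable (x : omega1) : countable [set y | (y < x)%O].
Proof.
have /countable_injP[f finj] : countable [set y | wo_le y (val x)] :=
  asboolW (valP x).
apply/countable_injP; exists (f \o val) => y z.
rewrite !inE => /ltW yx /ltW zx e; apply/val_inj/finj => //; rewrite inE.
  exact: yx.
exact: zx.
Qed.

Lemma uncountable_set_nat : ~ countable [set: set nat].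
Proof.
move=> /countable_injP[f finj].
pose D := [set n | exists2 A : set nat, f A = n & ~ A n].
have nD : ~ D (f D).
  move=> /[dup] DfD [A fAD]; suff -> : A = D by [].
  by apply: finj => //; rewrite inE.
by apply: (nD); exists D.
Qed.

Lemma countable_setU1 T (A : set T) (x : T) :
  countable A -> countable (A `|` [set x]).
Proof.
move=> cA; rewrite -bigcup2E; apply: bigcup_countable => // -[|[|n]] _ //=.
Qed.

Lemma omega1_uncountable : ~ countable [set: omega1].
Proof.
move=> cO; pose S : set (set nat) := [set x | countable [set y | wo_le y x]].
have cS : countable S.
  apply: card_le_trans cO; apply: (@card_le_trans _ _ _ (val @` [set: omega1])).
    apply: subset_card_le => x Sx.
    by exists (exist _ x (introT (asboolP _) Sx) : omega1).
  exact: card_image_le.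
have [ST|/existsNP[a nSa]] := pselect (forall x, S x).
  by apply: uncountable_set_nat; apply: sub_countable cS; apply: subset_card_le.
have [|m nSm mmin] := @wo_le_min (~` S); first by exists a.
apply: nSm; rewrite /S /=.
apply: (@sub_countable _ _ _ (S `|` [set m])).
  apply: subset_card_le => y /= ym; have [Sy|nSy] := pselect (S y); first by left.
  by right; apply: wo_le_anti; rewrite ym mmin.
exact: countable_setU1.
Qed.

(** The ordinal successor. *)
Definition osucc (x : omega1) : omega1 := infimum x [set y | (x < y)%O].

Lemma osuccP (x : omega1) :
  (x < osucc x)%O /\ forall y, (x < y)%O -> (osucc x <= y)%O.
Proof.
pose A := [set y | (x < y)%O]; have A0 : A !=set0.
  apply: contrapT => nA; apply: omega1_uncountable.
  apply: (@sub_countable _ _ _ ([set y | (y < x)%O] `|` [set x])); last first.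
    exact/countable_setU1/omega1_lt_countable.
  apply: subset_card_le => y _ /=; case: (ltgtP y x) => [|xy|]; [by left| |by right].
  by exfalso; apply: nA; exists y.
have [m Am mmin] := omega1_min A0.
suff -> : osucc x = m by split => // y; exact: mmin.
rewrite /osucc /infimum -/A; case: ifPn => [/eqP A00|_].
  by have [a] := A0; rewrite A00.
have mI : infimums A m by split => // z zl; exact: zl.
case: xgetP => [z _ [zl zu]|/(_ m)]; last by [].
by apply/le_anti; rewrite zl// zu.
Qed.

(** ** The cardinal invariants b and c *)

Definition eventually_le (f g : nat -> nat) : Prop :=
  \forall n \near \oo, (f n <= g n)%N.

Definition unbounded (F : set (nat -> nat)) : Prop :=
  ~ exists g, forall f, F f -> eventually_le f g.

(* The cardinality of [K] is the least cardinality of an unbounded family. *)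
Definition is_bounding_number (T : Type) (K : set T) : Prop :=
  (exists2 F, unbounded F & F #= K) /\ (forall F, unbounded F -> K #<= F).

Definition b_eq_c : Prop := is_bounding_number [set: set nat].

(** ** Barriers *)


Definition initial_segment (s t : set nat) : Prop :=
  s `<=` t /\ forall i j, s i -> t j -> (j <= i)%N -> s j.

Definition family_restr (F : set {fset nat}) (M : set nat) : set {fset nat} :=
  [set s | F s /\ [set` s] `<=` M].

Definition barrier_on (M : set nat) (B : set {fset nat}) : Prop :=
  [/\ forall s, B s -> [set` s] `<=` M,
      forall s t, B s -> B t -> [set` s] `<=` [set` t] -> s = t
    & forall N, infinite_set N -> N `<=` M ->
        exists2 s, B s & initial_segment [set` s] N].

(** ** Rank *)

Definition tree (B : set {fset nat}) : set {fset nat} :=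
  [set s | exists2 t, B t & initial_segment [set` s] [set` t]].

(* Recursive equation of the rank on a tree [T]; the supremum of the empty set
   is the least element of [omega1], that is, 0.  When [T] is the tree of a
   barrier, proper end-extension is well-founded on [T] and the equation
   determines [rho] on [T]. *)
Definition is_rank_function (T : set {fset nat}) (rho : {fset nat} -> omega1) :=
  forall s, T s ->
    supremums [set osucc (rho t) | t in
      [set t | [/\ T t, initial_segment [set` s] [set` t] & s <> t]]] (rho s).

Definition has_rank (B : set {fset nat}) (alpha : omega1) : Prop :=
  exists2 rho, is_rank_function (tree B) rho & rho fset0 = alpha.

(** ** Sequential compactness *)

(* A function on a family [B] is the restriction to [B] of a total function
   on [{fset nat}]; only its values on [B] matter. *)
Definition converges_to (X : topologicalType) (M : set nat)
    (B : set {fset nat}) (f : {fset nat} -> X) (x : X) : Prop :=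
  forall U : set X, open U -> U x ->
    exists n, f @` family_restr B (M `\` `I_n) `<=` U.

Definition barrier_seq_compact (B : set {fset nat}) (X : topologicalType) :=
  forall f : {fset nat} -> X,
    exists2 M : set nat, infinite_set M &
      exists x, converges_to M (family_restr B M) f x.

Definition seq_compact (alpha : omega1) (X : topologicalType) : Prop :=
  forall B, barrier_on [set: nat] B -> has_rank B alpha ->
    barrier_seq_compact B X.

(* Main.v *)
(* Fix an injection e of the ordinals below alpha into the naturals. Reading a
   set of naturals in increasing order, each element n lowers the current
   ordinal b (initially alpha) to the largest c < b with e c <= n; the sets at
   which 0 is first reached form a barrier B of rank alpha. If C is a barrier of
   smaller rank and f maps C to finite sets, then f[C|N] misses B|H for some N
   and every sufficiently sparse H: the rank of the node of C read so far cannot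
   catch up with the ordinal that is left in B.

   Sequentially compact spaces of character below the bounding number are
   C-sequentially compact for all barriers C, so, as the bounding number is the
   continuum, one can treat by recursion all pairs of a function f on a barrier of rank below alpha and an infinite set M. At a
   given stage f converges on some N in the one-point compactification of the
   Psi-space of the almost disjoint sets D chosen so far. Then a new D in B|H is
   chosen, one set for each minimum in H, with H contained in M and so sparse
   that D is almost disjoint from the earlier ones and that every treated f
   converging to infinity still does so. The final space is therefore
   gamma-sequentially compact for all gamma < alpha, while the inclusion of B|M converges
   neither to infinity, because of the D chosen inside M, nor to any other
   point. *)

From HB Require Import structures.
Require Import Defs.
From mathcomp Require Import all_boot all_order finmap.
From mathcomp Require Import boolp classical_sets functions cardinality.
From mathcomp Require Import filter topology.

Set Implicit Arguments.
Unset Strict Implicit.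
Unset Printing Implicit Defensive.

Import Order.TTheory.
Local Open Scope classical_set_scope.
Local Open Scope nat_scope.

(** * Infinite sets of naturals and joint domination *)

Definition cofinal (N : set nat) : Prop := forall n, exists2 i, N i & n <= i.

Lemma infinite_cofinal (N : set nat) : infinite_set N <-> cofinal N.
Proof.
split=> [iN n|cN fN].
  apply: contrapT => /forall2NP nN; apply: iN.
  apply: (@sub_finite_set _ _ `I_n); last exact: finite_II.
  by move=> i Ni /=; rewrite ltnNge; apply/negP => ni; case: (nN i).
have [l lN] : exists l : seq nat, forall i, N i -> i \in l.
  by have /finite_seqP[l ->] := fN; exists l.
have [i Ni] := cN (\max_(i <- l) i).+1.
by rewrite ltnNge => /negP; apply; apply: (@leq_bigmax_seq _ l xpredT id) => //; exact: lN.
Qed.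

Lemma cofinal_from (N : set nat) n : cofinal N -> cofinal (N `&` [set i | n <= i]).
Proof.
move=> cN m; have [i Ni] := cN (maxn n m).
by rewrite geq_max => /andP[ni mi]; exists i.
Qed.

Definition open_dense (Q : set nat -> Prop) : Prop :=
  (forall N, cofinal N -> exists N', [/\ cofinal N', N' `<=` N & Q N']) /\
  (forall N N', N' `<=` N -> Q N -> Q N').

Lemma open_dense_seq (T : eqType) (l : seq T) (Q : T -> set nat -> Prop) :
  (forall c, open_dense (Q c)) -> open_dense (fun N => forall c, c \in l -> Q c N).
Proof.
move=> odQ; split=> [|N N' N'N QN c cl]; last first.
  by apply: (proj2 (odQ c)) N'N _; exact: QN.
elim: l => [|c l IH] N cN; first by exists N; split.
have [N1 [cN1 N1N QN1]] := IH _ cN.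
have [N2 [cN2 N21 QN2]] := proj1 (odQ c) _ cN1.
exists N2; split=> //; first by move=> i /N21/N1N.
move=> d; rewrite inE => /orP[/eqP->//|dl].
exact: (proj2 (odQ d)) N21 (QN1 _ dl).
Qed.

(** Diagonalization: pick a point [a k] of the current set, shrink the rest into [Q (a k)], and
    repeat. The chosen points beyond [a k] all lie in that shrunken set, so openness applies. *)
Lemma fusion (Q : nat -> set nat -> Prop) (N0 : set nat) :
  (forall i, open_dense (Q i)) -> cofinal N0 ->
  exists N, [/\ cofinal N, N `<=` N0
    & forall i, N i -> Q i (N `&` [set j | i < j])].
Proof.
move=> odQ cN0.
have /choice[g gP] (N : set nat) : exists p : nat * set nat, cofinal N ->
    [/\ N p.1, cofinal p.2, p.2 `<=` N `&` [set j | p.1 < j] & Q p.1 p.2].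
  have [cN|ncN] := pselect (cofinal N); last by exists (0, N).
  have [i Ni _] := cN 0.
  have [N' [cN' N'N QN']] := proj1 (odQ i) _ (@cofinal_from _ i.+1 cN).
  by exists (i, N').
pose St k := iter k (fun N => (g N).2) N0; pose a k := (g (St k)).1.
have cSt k : cofinal (St k) by elim: k => //= k /gP[].
have Sta k : St k (a k) by have [] := gP _ (cSt k).
have StS k : St k.+1 `<=` St k `&` [set j | a k < j] by have [] := gP _ (cSt k).
have Stm k l : k <= l -> St l `<=` St k.
  move=> /subnK <-; elim: (l - k) => // m IH i; rewrite addSn => /StS[+ _].
  exact: IH.
have aS k l : k < l -> a k < a l.
  by move=> kl; have /(Stm _ _ kl)/StS[] := Sta l.
have aid k : k <= a k.
  by elim: k => // k IH; apply: leq_ltn_trans IH _; exact: aS.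
exists (range a); split.
- by move=> n; exists (a n) => //; exists n.
- by move=> _ [k _ <-]; apply: (Stm 0 k).
- move=> _ [k _ <-]; have [_ _ _] := gP _ (cSt k).
  apply: (proj2 (odQ _)) => _ [[l _ <-]] /= kl.
  have [lk|kl'] := leqP l k; last exact: (Stm k.+1 l).
  move: kl; rewrite ltnNge => /negP[]; move: lk; rewrite leq_eqVlt.
  by move=> /orP[/eqP->//|/aS/ltnW].
Qed.

Definition sparse (g : nat -> nat) (H : set nat) : Prop :=
  forall i j, H i -> H j -> i < j -> g i <= j.

Lemma sparse_subset (g : nat -> nat) (N0 : set nat) : cofinal N0 ->
  exists N, [/\ cofinal N, N `<=` N0 & sparse g N].
Proof.
move=> cN0; pose Q i (N : set nat) := forall j, N j -> g i <= j.
have [|N [cN N0N QN]] := @fusion Q N0 _ cN0.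
  move=> i; split=> [N cN|N N' N'N QN j /N'N]; last exact: QN.
  exists (N `&` [set j | g i <= j]); split; first exact: cofinal_from.
  - exact: subIsetl.
  - by move=> j [].
by exists N; split=> // i j Ni Nj ij; apply: (QN i Ni); split.
Qed.

Lemma eventually_leP (f g : nat -> nat) :
  eventually_le f g <-> exists n0, forall n, n0 <= n -> f n <= g n.
Proof. by split=> [[n0 _ H]|[n0 H]]; exists n0. Qed.

(** What cardinality below the bounding number provides: functions indexed by [A] have a common
    eventual bound. Countable sets have it outright; under [b_eq_c] so does every set smaller than
    the continuum. *)
Definition jointly_bounded (T : Type) (A : set T) : Prop :=
  forall h : T -> nat -> nat, exists g, forall a, A a -> eventually_le (h a) g.

Lemma jointly_boundedU (T : Type) (A B : set T) :
  jointly_bounded A -> jointly_bounded B -> jointly_bounded (A `|` B).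
Proof.
move=> bA bB h; have [g1 g1P] := bA h; have [g2 g2P] := bB h.
exists (fun n => maxn (g1 n) (g2 n)) => a [/g1P|/g2P] /eventually_leP[n0 H];
  apply/eventually_leP; exists n0 => n /H ?; rewrite leq_max.
- by apply/orP; left.
- by apply/orP; right.
Qed.

Lemma jointly_bounded_image (T U : Type) (A : set T) (f : T -> U) :
  jointly_bounded A -> jointly_bounded (f @` A).
Proof.
move=> bA h; have [g gP] := bA (h \o f).
by exists g => _ [a Aa <-]; exact: gP.
Qed.

Lemma countable_jointly_bounded (T : Type) (A : set T) :
  countable A -> jointly_bounded A.
Proof.
move=> /countable_injP[c cinj] h.
have /choice[k kP] n : exists o : option T,
    forall a, A a -> c a = n -> o = Some a.
  have [[a Aa can]|nA] := pselect (exists2 a, A a & c a = n); last first.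
    by exists None => a Aa can; case: nA; exists a.
  exists (Some a) => b Ab cbn; congr Some; apply: cinj; rewrite ?inE//.
  by rewrite can.
pose F n i := if k i is Some a then h a n else 0.
exists (fun n => \max_(i < n.+1) F n i) => a Aa.
apply/eventually_leP; exists (c a) => n cn.
have := @leq_bigmax _ (fun i : 'I_n.+1 => F n i) (Ordinal (cn : c a < n.+1)).
by rewrite /= /F (kP _ _ Aa erefl).
Qed.

(** * Nodes of a barrier and convergence *)

Definition starts (r s : {fset nat}) : Prop := initial_segment [set` r] [set` s].

Lemma starts_refl r : starts r r.
Proof. by split. Qed.

Lemma starts_trans s r t : starts r s -> starts s t -> starts r t.
Proof.
move=> [rs rs'] [st st']; split=> [i /rs/st//|i j ri tj ji].
by apply: (rs' i) => //; apply: (st' i) => //; exact: rs.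
Qed.

Lemma starts0 s : starts fset0 s.
Proof. by split=> [i|i j] /=; rewrite inE. Qed.

(** For [r] empty this is [C] restricted to [N]; the other nodes serve inductions along the tree. *)
Definition cone (C : set {fset nat}) (r : {fset nat}) (N : set nat) :
    set {fset nat} :=
  [set s | [/\ C s, starts r s & forall i, i \in s -> i \notin r -> N i]].

Lemma cone_sub C r (N N' : set nat) : N `<=` N' -> cone C r N `<=` cone C r N'.
Proof. by move=> NN' s [Cs rs sN]; split=> // i si ri; exact/NN'/sN. Qed.

Lemma tree_starts C r s : starts r s -> tree C s -> tree C r.
Proof. by move=> rs [t Ct st]; exists t => //; apply: starts_trans st. Qed.

Lemma sub_tree C s : C s -> tree C s.
Proof. by move=> Cs; exists s => //; exact: starts_refl. Qed.

Lemma barrier_leaf M C r s : barrier_on M C -> C r -> C s -> starts r s -> r = s.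
Proof. by move=> [_ antiC _] Cr Cs [rs _]; exact: antiC. Qed.

Lemma cofinal_barrier C N : barrier_on [set: nat] C -> cofinal N ->
  exists2 s, C s & initial_segment [set` s] N.
Proof. by move=> [_ _ segC] /infinite_cofinal cN; exact: segC. Qed.

Lemma tree0 C : barrier_on [set: nat] C -> tree C fset0.
Proof.
move=> bC; have [|s Cs _] := cofinal_barrier (N := setT) bC; first by move=> n; exists n.
by exists s => //; exact: starts0.
Qed.

(* The barrier has a member that is an initial segment of r, i and all the
   larger numbers; as r is a proper node, this member ends beyond i. *)
Lemma tree_step C r i : barrier_on [set: nat] C -> tree C r -> ~ C r ->
  (forall j, j \in r -> j < i) -> tree C (i |` r)%fset.
Proof.
move=> bC [t Ct rt] nCr ri.
pose N := [set j | j \in (i |` r)%fset \/ i < j].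
have [|s Cs [sN sN']] := cofinal_barrier (N := N) bC.
  by move=> n; exists (maxn n i.+1); [right; rewrite leq_max leqnn orbT|exact: leq_maxl].
have irs j : j \in (i |` r)%fset -> j \in s.
  move=> irj; apply/negPn/negP => js; apply: nCr.
  have ji : j <= i by move: irj; rewrite !inE => /orP[/eqP->//|/ri/ltnW].
  have sj x : x \in s -> x < j.
    move=> xs; rewrite ltnNge; apply/negP => jx.
    by move/negP: js; apply; apply: (sN' x) => //; left.
  have sr x : x \in s -> x \in r.
    move=> xs; have := sj _ xs => xj; have := sN x xs.
    case=> [|ix]; last by have := ltn_trans ix xj; rewrite ltnNge ji.
    by rewrite !inE => /orP[/eqP xi|//]; move: xj; rewrite xi ltnNge ji.
  suff <- : s = r by [].
  have st : s = t.
    by case: bC => _ + _; apply=> // x /= /sr; exact: (proj1 rt).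
  by apply/fsetP => x; apply/idP/idP => [/sr//|/(proj1 rt)]; rewrite st.
exists s => //; split=> // k j /= irk sj jk.
have := sN j sj; case=> // ij.
by move: irk; rewrite !inE => /orP[/eqP ki|/ri ki];
  have := leq_trans ij jk; rewrite ?ki ?ltnn// ltnNge (ltnW ki).
Qed.

Lemma starts_step (r s : {fset nat}) : starts r s -> r <> s -> exists i,
  [/\ i \in s, i \notin r, (forall j, j \in r -> j < i), starts (i |` r)%fset s
    & forall j, j \in s -> j \notin (i |` r)%fset -> i < j].
Proof.
move=> [rs rs'] nrs.
have [|i /andP[si ri] imin] := @ex_minnP (fun i => (i \in s) && (i \notin r)).
  apply: contrapT => nex; apply: nrs; apply/fsetP => x; apply/idP/idP => [/rs//|sx].
  by apply/negPn/negP => rx; apply: nex; exists x; rewrite sx.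
have rlt j : j \in r -> j < i.
  move=> jr; rewrite ltnNge; apply/negP => ij.
  by move/negP: ri; apply; apply: (rs' j).
exists i; split=> //.
  split=> [j /=|k j /=]; first by rewrite !inE => /orP[/eqP->//|/rs].
  move=> irk sj jk; rewrite !inE; case: (boolP (j \in r)) => jr; first exact: orbT.
  have ij : i <= j by apply: imin; rewrite sj.
  have ki : k <= i by move: irk; rewrite !inE => /orP[/eqP->//|/rlt/ltnW].
  by rewrite orbF eqn_leq ij (leq_trans jk ki).
move=> j sj; rewrite !inE negb_or => /andP[ji jr].
by rewrite ltn_neqAle eq_sym ji imin ?sj.
Qed.

(** Makes induction on the ordinal of a node possible. Rank functions of barriers have it, and so
    does [urank] below. *)
Definition rank_drops (C : set {fset nat}) (rho : {fset nat} -> omega1) : Prop :=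
  forall r s, tree C r -> tree C s -> starts r s -> r <> s -> (rho s < rho r)%O.

Lemma omega1_ind (P : omega1 -> Prop) :
  (forall x, (forall y, (y < x)%O -> P y) -> P x) -> forall x, P x.
Proof.
move=> IH x; apply: contrapT => nPx.
have [|m nPm mmin] := @omega1_min (~` P); first by exists x.
apply: nPm; apply: IH => y ym; apply: contrapT => nPy.
by have := mmin y nPy; rewrite leNgt ym.
Qed.

(** [S] acts as a subbase: convergence is tested on its members alone, so that a jointly bounded [S]
    can be treated with a single dominating function. *)
Definition cone_cvg (X : Type) (S : set (set X)) (C : set {fset nat})
    (r : {fset nat}) (N : set nat) (f : {fset nat} -> X) (x : X) : Prop :=
  forall U, S U -> U x ->
    exists n, forall s, cone C r (N `&` [set i | n <= i]) s -> U (f s).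

Definition subsequences_cvg (X : Type) (S : set (set X)) : Prop :=
  forall (y : nat -> X) N0, cofinal N0 -> exists N x,
    [/\ cofinal N, N `<=` N0
      & forall U, S U -> U x -> exists n, forall i, N i -> n <= i -> U (y i)].

Lemma cone_cvg_sub X (S : set (set X)) C r (N N' : set nat) f x :
  N' `<=` N -> cone_cvg S C r N f x -> cone_cvg S C r N' f x.
Proof.
move=> N'N fx U SU Ux; have [n nP] := fx U SU Ux; exists n => s.
by move=> /(cone_sub (N' := N `&` [set i | n <= i])) => H; apply/nP/H; apply: setSI.
Qed.

(* Induction on the rank of r: the limits y i over the immediate successors i of
   r subconverge to some x. For each U containing x, convergence to y i enters U
   after some h U i, and a g dominating all the h U makes any set that grows
   faster than g work for every U at once. *)
Theorem cone_subsequence (C : set {fset nat}) (rho : {fset nat} -> omega1)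
    (X : Type) (S : set (set X)) (f : {fset nat} -> X) :
  barrier_on [set: nat] C -> rank_drops C rho -> jointly_bounded S ->
  subsequences_cvg S -> forall r N0, tree C r -> cofinal N0 ->
  exists N x, [/\ cofinal N, N `<=` N0 & cone_cvg S C r N f x].
Proof.
move=> bC drop bS seqS r.
have [a] : exists a, rho r = a by exists (rho r).
elim/omega1_ind: a r => a IH r ra N0 Tr cN0.
have [Cr|nCr] := pselect (C r).
  exists N0, (f r); split=> // U SU Ur; exists 0 => s [Cs rs _].
  by rewrite -(barrier_leaf bC Cr Cs rs).
pose Q i (N : set nat) := (forall j, j \in r -> j < i) ->
  exists x, cone_cvg S C (i |` r)%fset N f x.
have [i|N1 [cN1 N10 QN1]] := @fusion Q N0 _ cN0.
  split=> [N cN|N N' N'N QN ri]; last first.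
    by have [x xP] := QN ri; exists x; exact: cone_cvg_sub xP.
  have [ri|nri] := pselect (forall j, j \in r -> j < i); last by exists N; split.
  have Tir := tree_step bC Tr nCr ri.
  have lt_a : (rho (i |` r)%fset < a)%O.
    rewrite -ra; apply: drop => //.
      split=> [j|k j] /=; first by rewrite !inE => ->; rewrite orbT.
      rewrite !inE => kr /orP[/eqP->|//] ik.
      by have := ri _ kr; rewrite ltnNge ik.
    by move=> rir; have := ri i; rewrite rir !inE eqxx ltnn => /(_ isT).
  have [N' [x [cN' N'N xP]]] := IH _ lt_a _ erefl _ Tir cN.
  by exists N'; split=> // _; exists x.
have /choice[y yP] i : exists x, N1 i -> (forall j, j \in r -> j < i) ->
    cone_cvg S C (i |` r)%fset (N1 `&` [set j | i < j]) f x.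
  have [[N1i ri]|nH] := pselect (N1 i /\ forall j, j \in r -> j < i).
    by have [x xP] := QN1 i N1i ri; exists x.
  by exists (f fset0) => N1i ri; case: nH.
have [N2 [x [cN2 N21 yx]]] := seqS y _ cN1.
have /choice[h hP] (U : set X) : exists h : nat -> nat, forall i, S U -> U (y i) -> N1 i ->
    (forall j, j \in r -> j < i) -> forall s, cone C (i |` r)%fset
    (N1 `&` [set j | i < j] `&` [set j | h i <= j]) s -> U (f s).
  have /choice[h hP] i : exists n, S U -> U (y i) -> N1 i ->
    (forall j, j \in r -> j < i) -> forall s, cone C (i |` r)%fset
    (N1 `&` [set j | i < j] `&` [set j | n <= j]) s -> U (f s).
    have [[[SU Uy] [N1i ri]]|nH] := pselect ((S U /\ U (y i)) /\
      (N1 i /\ forall j, j \in r -> j < i)); last by exists 0 => ? ? ? ?; case: nH.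
    by have [n nP] := yP i N1i ri U SU Uy; exists n.
  by exists h.
have [g gP] := bS h.
have [N3 [cN3 N32 spN3]] := sparse_subset g cN2.
have N30 : N3 `<=` N0 by move=> i /N32/N21/N10.
exists N3, x; split=> // U SU Ux.
have [n1 n1P] := yx U SU Ux; have /eventually_leP[n2 n2P] := gP U SU.
exists (maxn n1 n2) => s [Cs rs sN].
have [|i [si ri rlti irs imin]] := starts_step rs.
  by move=> rs'; apply: nCr; rewrite rs'.
have [N3i] := sN i si ri; rewrite /= geq_max => /andP[n1i n2i].
have N1i : N1 i by exact/N21/N32.
apply: (hP U i) => //; first by apply: n1P => //; exact: N32.
split=> // j sj jir.
have ij := imin j sj jir.
have [|N3j _] := sN j sj; first by move: jir; rewrite !inE negb_or => /andP[].
split; first by split=> //; exact/N21/N32.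
by rewrite /=; apply: leq_trans (n2P _ n2i) _; exact: spN3.
Qed.

Lemma barrier_has_rank_drops C (c : omega1) : barrier_on [set: nat] C -> has_rank C c ->
  exists2 rho, rank_drops C rho & rho fset0 = c.
Proof.
move=> bC [rho rhoP rho0]; exists rho => // r s Tr Ts rs nrs.
apply: (@lt_le_trans _ _ (osucc (rho s))); first exact: (proj1 (osuccP _)).
by have [ub _] := rhoP r Tr; apply: ub; exists s.
Qed.

(** * One-point compactifications of Psi-spaces *)

Lemma eventually_seq (T : eqType) (l : seq T) (E : T -> nat -> Prop) :
  (forall c m n, m <= n -> E c m -> E c n) ->
  (forall c, c \in l -> exists n, E c n) ->
  exists n, forall c, c \in l -> E c n.
Proof.
move=> Emon; elim: l => [|c l IH] lE; first by exists 0.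
have [|n nP] := IH; first by move=> d dl; apply: lE; rewrite inE dl orbT.
have [m mP] := lE c (mem_head _ _); exists (maxn m n) => d.
rewrite inE => /orP[/eqP->|/nP]; last exact/Emon/leq_maxr.
by apply: Emon mP; exact: leq_maxl.
Qed.

Lemma fsets_below n : exists l : seq {fset nat},
  forall s : {fset nat}, (forall i, i \in s -> i < n) -> s \in l.
Proof.
exists (enum_fset (fpowerset [fset i in iota 0 n]%fset)) => s sn.
suff : s \in fpowerset [fset i in iota 0 n]%fset by [].
by rewrite fpowersetE; apply/fsubsetP => i /sn ilt; rewrite in_fset mem_iota.
Qed.

(** This is finiteness of [F], since only finitely many finite sets lie below a given number. *)
Definition fset_bounded (F : set {fset nat}) : Prop :=
  exists n, forall s, F s -> forall i, i \in s -> i < n.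

Lemma eventually_bounded (F : set {fset nat}) (E : {fset nat} -> nat -> Prop) :
  fset_bounded F -> (forall s m n, m <= n -> E s m -> E s n) ->
  (forall s, F s -> exists n, E s n) -> exists n, forall s, F s -> E s n.
Proof.
move=> [b bP] Emon FE; have [l lP] := fsets_below b.
have [||n nP] := @eventually_seq _ l (fun s n => F s -> E s n).
- by move=> s m n mn EF /EF; exact: Emon.
- move=> s _; have [Fs|nFs] := pselect (F s); last by exists 0.
  by have [n nP] := FE s Fs; exists n.
- by exists n => s Fs; apply: nP => //; apply: lP; exact: bP.
Qed.

(* The finite sets of numbers, an extra point for each index, and a point at
   infinity. *)
Definition psi : Type := ({fset nat} + option (set nat))%type.

Definition psi_nbhd (D : set nat -> set {fset nat}) (x : set nat) : set psi :=
  [set y | match y with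
           | inl s => D x s
           | inr (Some x') => x = x'
           | inr None => False
           end].

(** Closed under complements. Extra points with index outside [A] lie in the same subbasic sets as
    infinity. *)
Definition psi_subbase (D : set nat -> set {fset nat}) (A : set (set nat)) :
    set (set psi) :=
  range (fun s : {fset nat} => [set (inl s : psi)]) `|`
  range (fun s : {fset nat} => ~` [set (inl s : psi)]) `|`
  (psi_nbhd D @` A `|` (fun x => ~` psi_nbhd D x) @` A).

Definition almost_disjoint (D : set nat -> set {fset nat}) (A : set (set nat)) :=
  forall x y, A x -> A y -> x <> y -> fset_bounded (D x `&` D y).

Lemma psi_subbase_bounded D A : jointly_bounded A -> jointly_bounded (psi_subbase D A).
Proof.
move=> bA; apply: jointly_boundedU; apply: jointly_boundedU;
  apply: jointly_bounded_image => //; exact/countable_jointly_bounded/countableP.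
Qed.

(** Either a value repeats infinitely often, or some [psi_nbhd D x] is visited infinitely often, or
    the sequence tends to infinity. In the second case the limit is the extra point [x]: another
    neighbourhood [z] shares with it only the finitely many sets in [D x] and [D z], and each of
    these is eventually avoided. *)
Lemma psi_subsequences D A : almost_disjoint D A -> subsequences_cvg (psi_subbase D A).
Proof.
move=> adD y N0 cN0.
have [[x cx]|nx] := pselect (exists x, cofinal (N0 `&` [set i | y i = x])).
  exists (N0 `&` [set i | y i = x]), x; split=> // U _ Ux.
  by exists 0 => i [_ /= ->].
have avoid x : exists n, forall i, N0 i -> n <= i -> y i <> x.
  apply: contrapT => nE; apply: nx; exists x => n; apply: contrapT => nI.
  by apply: nE; exists n => i N0i ni yix; apply: nI; exists i.
have [[x Ax cx]|nD] := pselect (exists2 x, A x &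
    cofinal (N0 `&` [set i | psi_nbhd D x (y i)])).
  exists (N0 `&` [set i | psi_nbhd D x (y i)]), (inr (Some x)).
  split=> // U.
  case=> [[[s _ <-]//|[s _ <-] _]|[[z Az <-] /= ->|[z Az <-] /= zx]].
  - by have [n nP] := avoid (inl s); exists n => i [N0i _]; exact: nP.
  - by exists 0 => i [].
  - have [||n nP] := eventually_bounded (E := fun s n => forall i, N0 i -> n <= i ->
      y i <> inl s) (adD x z Ax Az (fun e => zx (esym e))).
    + by move=> s m n mn Em i N0i ni; apply: Em => //; exact: leq_trans ni.
    + by move=> s _; exact: avoid.
    exists n => i [N0i /= xyi] ni zyi.
    case: (y i) (fun s Fs => nP s Fs i N0i ni) xyi zyi => [s /(_ s) + Dx Dz|[w _ <-|]] //.
    by move=> /(_ (conj Dx Dz)).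
exists N0, (inr None); split=> // U.
case=> [[[s _ <-]//|[s _ <-] _]|[[z Az <-]//|[z Az <-] _]].
  by have [n nP] := avoid (inl s); exists n.
apply: contrapT => nE; apply: nD; exists z => // n; apply: contrapT => nI.
by apply: nE; exists n => i N0i ni zyi; apply: nI; exists i.
Qed.

Lemma open_denseI Q Q' : open_dense Q -> open_dense Q' -> open_dense (fun N => Q N /\ Q' N).
Proof.
move=> [dQ oQ] [dQ' oQ']; split=> [N /dQ[N1 [/dQ'[N2 [cN2 N21 Q2] N1N Q1]]]|N N' N'N [QN Q'N]].
  by exists N2; split=> [//|i /N21/N1N//|]; split=> //; exact: oQ Q1.
by split; [exact: oQ QN|exact: oQ' Q'N].
Qed.

(** * Recursion along the continuum *)

Local Open Scope card_scope.

(** If no function dominated all the [h a], they would form an unbounded family no larger than [A],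
    hence [A] would have size at least the continuum. *)
Lemma small_jointly_bounded (T : Type) (A : set T) :
  b_eq_c -> ~ ([set: set nat] #<= A) -> jointly_bounded A.
Proof.
move=> [_ bmin] nA h; apply: contrapT => nb; apply: nA.
apply: card_le_trans (card_image_le h A); apply: bmin => -[g gP].
by apply: nb; exists g => a Aa; apply: gP; exists a.
Qed.

Definition wo_lt (x y : set nat) : Prop := wo_le x y /\ x <> y.

Lemma wo_lt_trans x y z : wo_lt x y -> wo_lt y z -> wo_lt x z.
Proof.
move=> [xy nxy] [yz nyz]; split; first exact: wo_le_trans yz.
by move=> xz; apply: nxy; apply: wo_le_anti; rewrite xy xz.
Qed.

Lemma wo_lt_min (A : set (set nat)) : A !=set0 ->
  exists2 x, A x & forall y, A y -> ~ wo_lt y x.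
Proof.
move=> /wo_le_min[x Ax xmin]; exists x => // y Ay [yx nyx].
by apply: nyx; apply: wo_le_anti; rewrite yx xmin.
Qed.

Lemma wo_lt_wf : well_founded wo_lt.
Proof.
move=> x; apply: contrapT => nx.
have [|y ny ymin] := @wo_lt_min (~` Acc wo_lt); first by exists x.
apply: ny; constructor=> z zy; apply: contrapT => nz; exact: (ymin z).
Qed.

(* If some proper initial segment of the well-order has size c, then the least
   such segment carries a well-order of type c, pulled back along j. *)
Lemma short_well_order : b_eq_c -> exists lt : set nat -> set nat -> Prop,
  [/\ well_founded lt, forall x y z, lt x y -> lt y z -> lt x z,
      forall x y, x <> y -> lt x y \/ lt y x
    & forall x, jointly_bounded [set y | lt y x]].
Proof.
move=> bc.
have [j jinj jsmall] : exists2 j : set nat -> set nat, injective j &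
    forall x, ~ ([set: set nat] #<= [set y | wo_lt y (j x)]).
  have [[x0 x0P]|nx] := pselect (exists x, [set: set nat] #<= [set y | wo_lt y x]);
    last by exists id => // x xP; apply: nx; exists x.
  have [|m mP mmin] := @wo_lt_min [set x | [set: set nat] #<= [set y | wo_lt y x]].
    by exists x0.
  have /pcard_leP/injfunPex[j jm jinj] : [set: set nat] #<= [set y | wo_lt y m] by [].
  exists j => [x y|x xP]; first by apply: jinj; rewrite inE.
  by apply: (mmin (j x) xP); exact: jm.
exists (fun x y => wo_lt (j x) (j y)); split.
- move=> x; have [y] : exists y, j x = y by exists (j x).
  elim/(well_founded_ind wo_lt_wf): y x => y IH x jx.
  by constructor=> w; rewrite jx => /IH; apply.
- by move=> x y z; exact: wo_lt_trans.
- move=> x y nxy; have njxy : j x <> j y by move=> /jinj.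
  by have [xy|yx] := orP (wo_le_total (j x) (j y)); [left|right]; split=> // /esym.
- move=> x; apply: small_jointly_bounded => // lec; apply: (jsmall x).
  have le1 : [set: set nat] #<= j @` [set y | wo_lt (j y) (j x)].
    by rewrite (card_le_eqr (inj_card_eq (in2W jinj))).
  by apply: card_le_trans le1 (subset_card_le _) => _ [y yx <-].
Qed.

(** Transfinite recursion for requirements [R x] that see only the values at and below [x]. Of the
    [q] supplied by the step at [x], only the value at [x] is kept. *)
Lemma wf_choose (I Dat : Type) (lt : I -> I -> Prop) (d0 : Dat)
    (R : I -> (I -> Dat) -> Prop) :
  well_founded lt -> (forall x y z, lt x y -> lt y z -> lt x z) ->
  (forall x p q, (forall y, lt y x \/ y = x -> p y = q y) -> R x p -> R x q) ->
  (forall x p, (forall y, lt y x -> R y p) -> exists q,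
    R x q /\ forall y, lt y x -> q y = p y) ->
  exists p, forall x, R x p.
Proof.
move=> wf tr ext step.
have /choice[c cP] (xp : I * (I -> Dat)) : exists q, (forall y, lt y xp.1 -> R y xp.2) ->
    R xp.1 q /\ forall y, lt y xp.1 -> q y = xp.2 y.
  have [/step[q qP]|nR] := pselect (forall y, lt y xp.1 -> R y xp.2).
    by exists q.
  by exists xp.2.
(* The values are known only below [x]; elsewhere [d0] is filled in, which [R y] cannot see for [y]
   below [x]. *)
pose restr x (f : forall y, lt y x -> Dat) y :=
  if pselect (lt y x) is left h then f y h else d0.
pose F x (f : forall y, lt y x -> Dat) : Dat := c (x, restr x f) x.
pose p := Fix wf (fun=> Dat) F.
have pE x : p x = F x (fun y _ => p y).
  rewrite /p Fix_eq // => y f g fg; congr F.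
  by apply: functional_extensionality_dep => w; apply: functional_extensionality_dep => h.
exists p; elim/(well_founded_ind wf) => x IH.
pose q := restr x (fun y _ => p y).
have qE y : lt y x -> q y = p y by rewrite /q /restr; case: pselect.
have [|Rc cq] := cP (x, q).
  move=> y yx; apply: ext (IH y yx) => w [wy|->] /=; last by rewrite qE.
  by rewrite /= qE//; exact: tr yx.
apply: ext Rc => y [yx|->]; first by rewrite cq//= qE.
by rewrite pE.
Qed.

(** [C], the graph of [f], and [M] together are a subset of the countable type [K], hence coded by
    one set of naturals. *)
Lemma task_coding : exists task : set nat ->
    set {fset nat} * ({fset nat} -> {fset nat}) * set nat,
  forall C f M, exists x, task x = (C, f, M).
Proof.
pose K := ({fset nat} + {fset nat} * {fset nat} + nat)%type.
have [code codeI] : exists code : K -> nat, injective code.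
  by exists choice.pickle; exact: pcan_inj choice.pickleK.
exists (fun x => ([set s | x (code (inl (inl s)))],
  fun s => xget fset0 [set u | x (code (inl (inr (s, u))))],
  [set m | x (code (inr m))])) => C f M.
pose holds (u : K) := match u with
  | inl (inl s) => C s | inl (inr (s, u)) => u = f s | inr m => M m end.
have codeP u : [set n | exists2 v, code v = n & holds v] (code u) <-> holds u.
  by split=> [[v /codeI ->]|]; last by exists u.
exists [set n | exists2 v, code v = n & holds v]; congr (_, _, _).
- by apply/seteqP; split=> s; case: (codeP (inl (inl s))).
- apply/funext => s; case: xgetP => [u _|/(_ (f s))].
    by case: (codeP (inl (inr (s, u)))) => + _; exact.
  by case; case: (codeP (inl (inr (s, f s)))) => _; exact.
- by apply/seteqP; split=> m; case: (codeP (inr m)).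
Qed.

Local Close Scope card_scope.

(** * Convergence along barriers in Psi-spaces *)

Lemma initial_segment_total (s t : {fset nat}) (N : set nat) :
  initial_segment [set` s] N -> initial_segment [set` t] N ->
  [set` s] `<=` [set` t] \/ [set` t] `<=` [set` s].
Proof.
move=> [sN sN'] [tN tN'].
have [|nst] := pselect ([set` s] `<=` [set` t]); [by left|right=> j tj].
have [i si nti] : exists2 i, i \in s & i \notin t.
  apply: contrapT => nex; apply: nst => i si; apply/negPn/negP => ti.
  by apply: nex; exists i.
apply: (sN' i) => //; first exact: tN.
rewrite leqNgt; apply/negP => ij; move/negP: nti; apply.
by apply: (tN' j) => //; [exact: sN|exact: ltnW].
Qed.

Lemma fset_boundedS (F G : set {fset nat}) : F `<=` G -> fset_bounded G -> fset_bounded F.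
Proof. by move=> FG [n nP]; exists n => s /FG; exact: nP. Qed.

Definition eventually_on (C : set {fset nat}) (N : set nat) (Pr : {fset nat} -> Prop) :=
  exists n, forall s, cone C fset0 (N `&` [set i | n <= i]) s -> Pr s.

Lemma eventually_on_sub C (N N' : set nat) Pr :
  N' `<=` N -> eventually_on C N Pr -> eventually_on C N' Pr.
Proof.
move=> N'N [n nP]; exists n => s Cs; apply: nP.
by apply: cone_sub Cs => i [/N'N].
Qed.

Lemma eventually_onW C N Pr n : (forall s, cone C fset0 (N `&` [set i | n <= i]) s -> Pr s) ->
  forall m, n <= m -> forall s, cone C fset0 (N `&` [set i | m <= i]) s -> Pr s.
Proof.
move=> nP m nm s Cs; apply: nP; apply: cone_sub Cs => i [Ni mi]; split=> //=.
exact: leq_trans mi.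
Qed.

Lemma eventually_onI C N Pr Pr' : eventually_on C N Pr -> eventually_on C N Pr' ->
  eventually_on C N (fun s => Pr s /\ Pr' s).
Proof.
move=> [m mP] [n nP]; exists (maxn m n) => s Cs.
by split; [move: Cs; apply: (eventually_onW mP); exact: leq_maxl
  |move: Cs; apply: (eventually_onW nP); exact: leq_maxr].
Qed.

Lemma eventually_on_bounded C N (F : set {fset nat}) (Pr : {fset nat} -> {fset nat} -> Prop) :
  fset_bounded F -> (forall u, F u -> eventually_on C N (Pr u)) ->
  eventually_on C N (fun s => forall u, F u -> Pr u s).
Proof.
move=> bF FP.
have [||n nP] := eventually_bounded (E := fun u n => forall s,
    cone C fset0 (N `&` [set i | n <= i]) s -> Pr u s) bF.
- by move=> u m n mn /eventually_onW; exact.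
- exact: FP.
- by exists n => s Cs u Fu; exact: nP.
Qed.

(** Convergence written out on basic neighbourhoods, relative to the extra points in [A] only, so
    that it makes sense at a stage where later sets [D x] are not yet chosen. Neighbourhoods of
    non-isolated points may omit any finite set [u], whence the clause [f s <> inl u]. *)
Definition psi_cvg (D : set nat -> set {fset nat}) (A : set (set nat))
    (C : set {fset nat}) (N : set nat) (f : {fset nat} -> psi) (x : psi) : Prop :=
  match x with
  | inl u => eventually_on C N (fun s => f s = inl u)
  | inr o =>
    (forall u, eventually_on C N (fun s => f s <> inl u)) /\
    match o with
    | Some x => A x /\ eventually_on C N (fun s => psi_nbhd D x (f s))
    | None => forall x, A x -> eventually_on C N (fun s => ~ psi_nbhd D x (f s))
    end
  end.

Lemma psi_cvg_sub D A C (N N' : set nat) f x :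
  N' `<=` N -> psi_cvg D A C N f x -> psi_cvg D A C N' f x.
Proof.
move=> N'N; case: x => [u|o] /=; first exact: eventually_on_sub.
move=> [Hu Ho]; split=> [u|]; first exact: (eventually_on_sub N'N (Hu u)).
case: o Ho => [x [Ax Hx]|H x Ax]; last exact: (eventually_on_sub N'N (H x Ax)).
by split=> //; exact: (eventually_on_sub N'N Hx).
Qed.

Lemma cone_psi_cvg D A C N f x : cone_cvg (psi_subbase D A) C fset0 N f x ->
  exists x', psi_cvg D A C N f x'.
Proof.
have sub1 u : psi_subbase D A [set (inl u : psi)] by left; left; exists u.
have sub2 u : psi_subbase D A (~` [set (inl u : psi)]) by left; right; exists u.
have sub3 y : A y -> psi_subbase D A (psi_nbhd D y) by right; left; exists y.
have sub4 y : A y -> psi_subbase D A (~` psi_nbhd D y) by right; right; exists y.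
case: x => [u|[y|]] fx.
- by exists (inl u); exact: (fx _ (sub1 u) erefl).
- have fu u : eventually_on C N (fun s => f s <> inl u) by exact: (fx _ (sub2 u)).
  have [Ay|nAy] := pselect (A y).
    by exists (inr (Some y)); split=> //; split=> //; exact: (fx _ (sub3 y Ay) erefl).
  (* An index [y] outside [A] has no subbasic neighbourhood of its own, so infinity is a limit as
     well. *)
  exists (inr None); split=> // w Aw; apply: (fx _ (sub4 w Aw)) => wy.
  by apply: nAy; rewrite -wy.
- exists (inr None); split=> [u|w Aw]; first exact: (fx _ (sub2 u)).
  exact: (fx _ (sub4 w Aw)).
Qed.

Lemma psi_cvg_eq D D' A C N f x : (forall y, A y -> D y = D' y) ->
  psi_cvg D A C N f x -> psi_cvg D' A C N f x.
Proof.
move=> DD'; case: x => [//|[x|]] /= [Hu Hx]; split=> //.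
  by case: Hx => Ax Hx; split=> //; rewrite /psi_nbhd -DD'.
by move=> x Ax; have := Hx x Ax; rewrite /psi_nbhd -DD'.
Qed.

(** * The topology of the final space *)

(** The sets [D x] converge to their extra points. For neighbourhoods of infinity, [l] lists
    finitely many extra points whose neighbourhoods cover the complement up to finitely many finite
    sets. *)
Definition psi_open (D : set nat -> set {fset nat}) (U : set psi) : Prop :=
  (forall x, U (inr (Some x)) -> fset_bounded (D x `&` [set s | ~ U (inl s)])) /\
  (U (inr None) -> exists l : seq (set nat),
    (forall x, x \notin l -> U (inr (Some x))) /\
    fset_bounded [set s | ~ U (inl s) /\ forall x, x \in l -> ~ D x s]).

Definition psi_space (D : set nat -> set {fset nat}) : Type := psi.

Lemma psi_openT D : psi_open D setT.
Proof.
split=> [x _|_]; first by exists 0 => s [_ []].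
by exists [::]; split=> //; exists 0 => s [[]].
Qed.

Lemma fset_boundedU (F G : set {fset nat}) :
  fset_bounded F -> fset_bounded G -> fset_bounded (F `|` G).
Proof.
move=> [m mP] [n nP]; exists (maxn m n) => s [/mP|/nP] H i /H ilt; rewrite leq_max ilt//.
by rewrite orbT.
Qed.

Lemma psi_openI D : setI_closed (psi_open D).
Proof.
move=> U V [U1 U2] [V1 V2]; split=> [x [/U1 bU /V1 bV]|[/U2[l [lU bU]] /V2[k [kV bV]]]].
  apply: fset_boundedS (fset_boundedU bU bV) => s [Ds nUV].
  have [Us|nU] := pselect (U (inl s)); last by left.
  by right; split=> // Vs; apply: nUV.
exists (l ++ k); split=> [x|].
  by rewrite mem_cat negb_or => /andP[/lU ? /kV ?].
apply: fset_boundedS (fset_boundedU bU bV) => s [nUV nD].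
have [Us|nU] := pselect (U (inl s)); [right|left]; split=> //.
- by move=> Vs; apply: nUV.
- by move=> x xk; apply: nD; rewrite mem_cat xk orbT.
- by move=> x xl; apply: nD; rewrite mem_cat xl.
Qed.

Lemma psi_open_bigU D (I : Type) (F : I -> set psi) :
  (forall i, psi_open D (F i)) -> psi_open D (\bigcup_i F i).
Proof.
move=> oF; split=> [x [i _ Fx]|[i _ /(proj2 (oF i))[l [lF bF]]]].
  apply: fset_boundedS (proj1 (oF i) x Fx) => s [Ds nF]; split=> // Fs.
  by apply: nF; exists i.
exists l; split=> [x /lF Fx|]; first by exists i.
by apply: fset_boundedS bF => s [nF nD]; split=> // Fs; apply: nF; exists i.
Qed.

HB.instance Definition _ D :=
  Choice.copy (psi_space D) ({fset nat} + option (set nat))%type.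
HB.instance Definition _ D :=
  isOpenTopological.Build (psi_space D) (@psi_openT D) (@psi_openI D) (@psi_open_bigU D).

Lemma psi_openE D (U : set (psi_space D)) : open U = psi_open D U.
Proof. by []. Qed.

Lemma psi_cvg_converges D C N (f : {fset nat} -> psi_space D) x :
  psi_cvg D setT C N f x -> converges_to N (family_restr C N) f x.
Proof.
move=> fx U; rewrite psi_openE => oU Ux.
suff [n nP] : eventually_on C N (fun s => U (f s)).
  exists n => _ [s [[Cs sN] sn] <-]; apply: nP; split=> // i si _.
  by have [Ni /negP] := sn i si; rewrite -leqNgt.
have avoid F : fset_bounded F -> (forall u, eventually_on C N (fun s => f s <> inl u)) ->
    eventually_on C N (fun s => forall u, F u -> f s <> inl u).
  by move=> bF fu; apply: (eventually_on_bounded (Pr := fun u s => f s <> inl u)).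
case: x fx Ux => [u [n nP]|[x|] [fu fo]] Ux.
- by exists n => s /nP ->.
- have [_ nbx] := fo; have := avoid _ (proj1 oU x Ux) fu => /(eventually_onI nbx)[n nP].
  exists n => s /nP[]; case: (f s) => [u|[x'|]] //= => [Dxu nU|<-//].
  by apply: contrapT => nUu; exact: (nU u).
- have [l [lU bU]] := proj2 oU Ux.
  have far : eventually_on C N (fun s => forall x, x \in l -> ~ psi_nbhd D x (f s)).
    have [||n nP] := @eventually_seq _ l (fun x n => forall s,
        cone C fset0 (N `&` [set i | n <= i]) s -> ~ psi_nbhd D x (f s)).
    + by move=> y m n mn /eventually_onW; exact.
    + by move=> y _; exact: fo.
    + by exists n => s Cs y yl; exact: nP.
  have [n nP] := eventually_onI far (avoid _ bU fu).
  exists n => s /nP[]; case: (f s) => [u|[x'|]] //= => [nD nU|nx' _].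
    by apply: contrapT => nUu; exact: (nU u).
  by apply: lU; apply/negP => /nx'.
Qed.

(** * A barrier of rank alpha *)

Lemma omega1_bot (a : omega1) : exists z : omega1, forall y, (z <= y)%O.
Proof.
have [|z _ zmin] := @omega1_min setT; first by exists a.
by exists z => y; exact: zmin.
Qed.

(* For 0 < b <= alpha, P b n is the largest ordinal c < b with e c <= n; z is 0. *)
Definition descent (alpha z : omega1) (e : omega1 -> nat)
    (P : omega1 -> nat -> omega1) : Prop :=
  [/\ forall y, (z <= y)%O,
      forall n, P z n = z,
      forall b n, (b <= alpha)%O -> (z < b)%O -> (P b n < b)%O,
      forall b n, (b <= alpha)%O -> (z < b)%O -> e (P b n) <= n
    & forall b c n, (b <= alpha)%O -> (c < b)%O -> e c <= n -> (c <= P b n)%O].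

(** Only finitely many [c] below [b] have [e c <= n]; their maximum is built by induction on [n]. *)
Lemma descent_exists (alpha : omega1) : exists z e P, descent alpha z e P.
Proof.
have [z zP] := omega1_bot alpha.
have /countable_injP[f finj] := omega1_lt_countable alpha.
(* Code 0 is reserved for [z], so that a candidate below [b] exists already for [n = 0]. *)
pose e c := if c == z then 0 else (f c).+1.
have einj b c : (b < alpha)%O -> (c < alpha)%O -> e b = e c -> b = c.
  rewrite /e => ba ca; case: eqP => [->|_]; case: eqP => [->|_] // [].
  by apply: finj; rewrite inE.
have /choice[P PP] (p : omega1 * nat) : exists m, (p.1 <= alpha)%O ->
    if p.1 == z then m = z else [/\ (m < p.1)%O, e m <= p.2
      & forall c, (c < p.1)%O -> e c <= p.2 -> (c <= m)%O].
  case: p => b n /=.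
  have [ba|nba] := boolP (b <= alpha)%O; last by exists z.
  case: eqP => [_|/eqP bz]; first by exists z.
  have zb : (z < b)%O by rewrite lt_neqAle eq_sym bz zP.
  elim: n => [|n [m /(_ isT) [mb mn mmax]]].
    exists z => _; split=> //; first by rewrite /e eqxx.
    by move=> c cb; rewrite /e; case: eqP => [->|].
  have [[c cb cn]|nc] := pselect (exists2 c, (c < b)%O & e c = n.+1); last first.
    exists m => _; split=> //; first exact: leqW.
    move=> c cb; rewrite leq_eqVlt => /orP[/eqP cn|]; last exact: mmax.
    by case: nc; exists c.
  exists (Order.max m c) => _; split.
  - by rewrite gt_max mb.
  - by rewrite /Order.max; case: ifP => _; rewrite ?cn// leqW.
  - move=> d db; rewrite leq_eqVlt le_max => /orP[/eqP dn|dn].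
      by rewrite (einj d c) ?lexx ?orbT// ?dn ?cn// (lt_le_trans _ ba).
    by rewrite mmax.
exists z, e, (fun b n => P (b, n)); split=> //.
- by move=> n; have := PP (z, n) (zP _); rewrite /= eqxx.
- by move=> b n ba zb; have := PP (b, n) ba; rewrite /= gt_eqF// => -[].
- by move=> b n ba zb; have := PP (b, n) ba; rewrite /= gt_eqF// => -[].
- move=> b c n ba cb; have zb : (z < b)%O by exact: le_lt_trans cb.
  by have := PP (b, n) ba; rewrite /= gt_eqF// => -[_ _]; exact.
Qed.

Lemma fset_ltn_bound (t : {fset nat}) : exists n, forall i, i \in t -> i < n.
Proof.
exists (\max_(i <- enum_fset t) (i : nat)).+1 => i it; rewrite ltnS.
by apply: (@leq_bigmax_seq nat (enum_fset t) xpredT (fun i => i)).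
Qed.

Definition fset_bound (t : {fset nat}) : nat := sval (cid (fset_ltn_bound t)).

Lemma fset_boundP t i : i \in t -> i < fset_bound t.
Proof. exact: (svalP (cid (fset_ltn_bound t))). Qed.

Section Uniform.
Variables (alpha z : omega1) (e : omega1 -> nat) (P : omega1 -> nat -> omega1).
Hypothesis dP : descent alpha z e P.

Fixpoint desc (A : set nat) (n : nat) : omega1 :=
  if n is m.+1 then if `[< A m >] then P (desc A m) m else desc A m else alpha.

Definition uniform_barrier : set {fset nat} :=
  [set t | exists m, [/\ m \in t, forall i, i \in t -> i <= m,
    (z < desc [set` t] m)%O & desc [set` t] m.+1 = z]].

(** The ordinal left once all of [t] is read. It turns out to be the rank of the node [t]. *)
Definition urank (t : {fset nat}) : omega1 := desc [set` t] (fset_bound t).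

Lemma descent_ge y : (z <= y)%O.
Proof. by case: dP. Qed.

Lemma ne_descent_gt y : y <> z -> (z < y)%O.
Proof. by move=> yz; rewrite lt_neqAle descent_ge andbT eq_sym; apply/eqP. Qed.

Lemma descent_le b n : (b <= alpha)%O -> (P b n <= b)%O.
Proof.
case: dP => _ Pz Plt _ _ ba; have [->|/ne_descent_gt zb] := pselect (b = z).
  by rewrite Pz.
exact/ltW/Plt.
Qed.

Lemma desc_le_alpha A n : (desc A n <= alpha)%O.
Proof.
elim: n => //= n IH; case: asboolP => // _.
exact: le_trans (descent_le _ IH) IH.
Qed.

Lemma descS_le A n : (desc A n.+1 <= desc A n)%O.
Proof. by rewrite /=; case: asboolP => // _; exact/descent_le/desc_le_alpha. Qed.

Lemma desc_le A m n : m <= n -> (desc A n <= desc A m)%O.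
Proof.
move=> /subnK <-; elim: (n - m) => // k IH; rewrite addSn.
exact: le_trans (descS_le _ _) IH.
Qed.

Lemma descS_lt A n : A n -> (z < desc A n)%O -> (desc A n.+1 < desc A n)%O.
Proof.
move=> An zA /=; case: asboolP => // _.
by case: dP => _ _ Plt _ _; apply: Plt => //; exact: desc_le_alpha.
Qed.

Lemma eq_desc A A' n : (forall i, i < n -> A i <-> A' i) -> desc A n = desc A' n.
Proof.
elim: n => //= n IH AA'; rewrite IH; last by move=> i ni; apply: AA'; exact: ltnW.
by rewrite (_ : `[< A n >] = `[< A' n >]) //; exact/asbool_equiv_eq/AA'.
Qed.

Lemma desc_stable A m n : m <= n -> (forall i, A i -> i < m) -> desc A n = desc A m.
Proof.
move=> /subnK <- Am; elim: (n - m) => // k IH; rewrite addSn /= IH.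
by case: asboolP => // /Am; rewrite ltnNge leq_addl.
Qed.

Lemma urankE (t : {fset nat}) n : (forall i, i \in t -> i < n) ->
  desc [set` t] n = urank t.
Proof.
move=> tn; rewrite /urank -(desc_stable (leq_maxl n (fset_bound t)))//.
by rewrite -(desc_stable (leq_maxr n (fset_bound t)))// => i; exact: fset_boundP.
Qed.

Lemma urank0 : urank fset0 = alpha.
Proof. by rewrite -(@urankE _ 0). Qed.

Lemma urank_le_alpha t : (urank t <= alpha)%O.
Proof. exact: desc_le_alpha. Qed.

Lemma urank_step (t : {fset nat}) k : (forall i, i \in t -> i < k) ->
  urank (k |` t)%fset = P (urank t) k.
Proof.
move=> tk; rewrite -(@urankE _ k.+1) /=; last first.
  by move=> i; rewrite !inE => /orP[/eqP->//|/tk/ltnW].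
case: asboolP => [_|[]]; last by rewrite /= !inE eqxx.
congr P; rewrite -(urankE tk); apply: eq_desc => i ik /=.
by rewrite !inE; have -> : i == k = false by exact/ltn_eqF.
Qed.

Lemma urank_barrier t : uniform_barrier t -> urank t = z.
Proof. by move=> [m [_ tm _ <-]]; rewrite -(@urankE _ m.+1). Qed.

(** Before the last element of a member [u] is read, the ordinal left is not yet [z], so each
    further element read strictly lowers it. *)
Lemma uniform_rank_drops : rank_drops uniform_barrier urank.
Proof.
move=> r s _ [u [m [mu um zm mz]] su] rs nrs.
have [i [si ri rlti irs imin]] := starts_step rs nrs.
have im : i <= m by apply/um/(proj1 su).
have su_lt j : j < i.+1 -> [set` s] j <-> [set` u] j.
  move=> ji; split=> [/(proj1 su)//|uj]; exact: (proj2 su i).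
have rs_lt j : j < i -> [set` r] j <-> [set` s] j.
  move=> ji; split=> [/(proj1 rs)//|sj /=]; apply/negPn/negP => rj.
  have := imin j sj; rewrite !inE negb_or rj andbT.
  by rewrite ltn_eqF// => /(_ isT); rewrite ltnNge ltnW.
have -> : urank r = desc [set` u] i.
  rewrite -(urankE rlti); apply: eq_desc => j ji.
  by apply: iff_trans (su_lt j (ltnW ji)); exact: rs_lt.
apply: (@le_lt_trans _ _ (desc [set` u] i.+1)).
  by rewrite -(eq_desc su_lt); apply/desc_le/fset_boundP.
apply: descS_lt; first exact: (proj1 su).
by apply: lt_le_trans zm _; exact: desc_le.
Qed.

(* Along members s of t the descent of t stays below that of s, and once an
   element of t is missing from s it stays strictly below: P (desc s n) n is
   then at least desc t n. *)
Lemma desc_subset (s t : set nat) n : s `<=` t ->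
  [\/ forall i, i < n -> t i -> s i,
      (desc t n < desc s n)%O /\ e (desc t n) <= n
    | desc t n = z].
Proof.
case: (dP) => _ Pz Plt Pe Pmax st.
elim: n => [|n IH]; first exact: Or31.
have [Dz|/ne_descent_gt Dz] := pselect (desc t n.+1 = z); first exact: Or33.
have zD : (z < desc t n)%O := lt_le_trans Dz (descS_le t n).
case: IH => [ts|[lt_ts en]|tz]; last by rewrite tz ltxx in zD.
  have E : desc t n = desc s n.
    by apply: eq_desc => i ni; split=> [|/st]; [exact: ts|].
  have [sn|nsn] := pselect (s n).
    by apply: Or31 => i; rewrite ltnS leq_eqVlt => /orP[/eqP->|/ts].
  have [tn|ntn] := pselect (t n); last first.
    by apply: Or31 => i; rewrite ltnS leq_eqVlt => /orP[/eqP->|/ts].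
  apply: Or32 => /=; rewrite (asboolT tn) (asboolF nsn) -E.
  split; first by apply: Plt => //; exact: desc_le_alpha.
  by apply: leqW; apply: Pe => //; exact: desc_le_alpha.
apply: Or32 => /=; have [tn|ntn] := pselect (t n); last first.
  have nsn : ~ s n by move=> /st.
  by rewrite (asboolF ntn) (asboolF nsn); split=> //; exact: leqW.
rewrite (asboolT tn); split; last first.
  by apply: leqW; apply: Pe => //; exact: desc_le_alpha.
apply: (@lt_le_trans _ _ (desc t n)); first by apply: Plt => //; exact: desc_le_alpha.
case: asboolP => _; last exact: ltW.
by apply: Pmax => //; exact: desc_le_alpha.
Qed.

(** Let [m] and [k] be the last elements of [s] and [t]. If [m < k], [desc_subset] at [m.+1] forces
    [t] to have reached [z] too early or to be below [z]. If [m = k] and [t] has an element missing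
    from [s], then by maximality [P] at [m] leaves [s] at least [desc t m], which is above [z]. *)
Lemma uniform_barrier_antichain s t : uniform_barrier s -> uniform_barrier t ->
  [set` s] `<=` [set` t] -> s = t.
Proof.
move=> [m [ms sm zm mz]] [k [kt tk zk kz]] st.
have mk : m <= k by apply/tk/st.
have nz n : n <= k -> desc [set` t] n <> z.
  by move=> nk tz; move: (desc_le [set` t] nk); rewrite tz leNgt zk.
have [mk'|km] := ltnP m k.
  case: (desc_subset m.+1 st) => [ts|[]|/(nz _ mk')//].
    case: (nz m.+1 mk'); rewrite -mz; apply: eq_desc => i im; split; first exact: ts.
    exact: st.
  by rewrite mz ltNge descent_ge.
have E : m = k by apply/eqP; rewrite eqn_leq mk.
rewrite -{}E {mk km} in kt tk zk kz nz.
case: (desc_subset m st) => [ts|[lt_ts em]|/nz] //; last by move=> /(_ (leqnn _)).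
  apply/fsetP => i; apply/idP/idP => [/st//|it].
  have := tk i it; rewrite leq_eqVlt => /orP[/eqP->//|im]; exact: ts.
have sm' : [set` s] m by [].
have [_ _ _ _ Pmax] := dP.
have := Pmax _ _ m (desc_le_alpha [set` s] m) lt_ts em.
by move: mz => /=; rewrite (asboolT sm') => ->; rewrite leNgt zk.
Qed.

(** Along an infinite [N] the descent drops at every element until it reaches [z]; the part of [N]
    read up to the first such moment is the required member. *)
Lemma uniform_barrierP : (z < alpha)%O -> barrier_on [set: nat] uniform_barrier.
Proof.
move=> za; split=> // [|N iN _]; first exact: uniform_barrier_antichain.
have cN := proj1 (infinite_cofinal N) iN.
have [n nz] : exists n, desc N n = z.
  have [|_ [n _ <-] nmin] := @omega1_min (range (desc N)).
    by exists (desc N 0), 0.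
  exists n; apply: contrapT => /ne_descent_gt zn.
  have [i Ni ni] := cN n.
  have le_in := nmin _ (ex_intro2 _ _ i.+1 I erefl).
  have zi : (z < desc N i)%O := lt_le_trans (lt_le_trans zn le_in) (descS_le N i).
  have := lt_le_trans (descS_lt Ni zi) (desc_le N ni).
  by rewrite ltNge le_in.
have [|m /eqP mz mmin] := @ex_minnP (fun n => desc N n == z).
  by exists n; apply/eqP.
case: m mz mmin => [az|m mz mmin]; first by move: za; rewrite -az ltxx.
have zm : (z < desc N m)%O.
  by apply: ne_descent_gt => /eqP /mmin; rewrite ltnn.
have Nm : N m.
  by apply: contrapT => nNm; move: mz zm => /=; rewrite (asboolF nNm) => ->; rewrite ltxx.
pose s := [fset i in iota 0 m.+1 | `[< N i >]]%fset.
have sE i : i \in s = (i <= m) && `[< N i >] by rewrite !inE mem_iota add1n ltnS; case: i.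
have sN i : i <= m -> [set` s] i <-> N i.
  by move=> im; rewrite /= sE im /=; split=> /asboolP.
exists s; last first.
  split=> [i|i j] /=; first by rewrite sE => /andP[_ /asboolP].
  rewrite !sE => /andP[im _] Nj ji; rewrite (leq_trans ji im); exact/asboolP.
exists m; split.
- by rewrite sE leqnn; exact/asboolP.
- by move=> i; rewrite sE => /andP[].
- by rewrite (@eq_desc _ N)// => i /ltnW; exact: sN.
- by rewrite (@eq_desc _ N).
Qed.

Lemma uniform_tree_step t k : barrier_on [set: nat] uniform_barrier ->
  tree uniform_barrier t -> (z < urank t)%O -> (forall i, i \in t -> i < k) ->
  tree uniform_barrier (k |` t)%fset.
Proof.
move=> bB Tt zt tk; apply: tree_step => // Bt.
by rewrite (urank_barrier Bt) ltxx in zt.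
Qed.

Lemma starts_step1 (t : {fset nat}) k : (forall i, i \in t -> i < k) ->
  starts t (k |` t)%fset.
Proof.
move=> tk; split=> [j|i j] /=; first by rewrite !inE => ->; rewrite orbT.
rewrite !inE => it /orP[/eqP->|//] ki.
by have := tk _ it; rewrite ltnNge ki.
Qed.

(** The upper bound is [uniform_rank_drops]. It is least because, for [y] below [urank s], appending
    a number that is at least [e y] leaves an ordinal of at least [y]. *)
Lemma uniform_has_rank : (z < alpha)%O -> has_rank uniform_barrier alpha.
Proof.
move=> za; exists urank; last exact: urank0.
have bB := uniform_barrierP za; case: (dP) => _ _ _ _ Pmax.
move=> s Ts; split=> [_ [t [Tt st nst] <-]|y yub].
  by apply: (proj2 (osuccP _)); exact: uniform_rank_drops.
rewrite leNgt; apply/negP => ys.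
pose k := maxn (fset_bound s) (e y).
have sk i : i \in s -> i < k by move=> /fset_boundP si; rewrite leq_max si.
have Tks : tree uniform_barrier (k |` s)%fset.
  by apply: uniform_tree_step => //; exact: le_lt_trans (descent_ge y) ys.
have := yub _ (ex_intro2 _ _ (k |` s)%fset _ erefl); rewrite leNgt => /(_ _)/negP.
apply.
  split=> //; first exact: starts_step1.
  by move=> E; have := sk k; rewrite E !inE eqxx ltnn => /(_ isT).
apply: le_lt_trans (proj1 (osuccP _)).
rewrite urank_step//; apply: Pmax => //; first exact: urank_le_alpha.
exact: leq_maxr.
Qed.

(** Reading the first element [k] leaves at least [g], which is still above [z], so another element
    must follow. Sparseness can then act on any member with large minimum. *)
Lemma uniform_second (g : omega1) s k : (z < g)%O -> (g < alpha)%O ->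
  uniform_barrier s -> e g <= k -> k \in s -> (forall i, i \in s -> k <= i) ->
  exists2 j, j \in s & k < j.
Proof.
move=> zg ga [m [ms sm zm mz]] gk ks kmin; exists m => //.
rewrite ltn_neqAle sm// andbT; apply/eqP => km; rewrite -{}km in ms sm zm mz.
case: (dP) => _ _ _ _ Pmax; have sk : [set` s] k by [].
have E : desc [set` s] k = alpha.
  rewrite (@eq_desc _ set0) ?(@desc_stable set0 0)// => i ik.
  by split=> // /kmin; rewrite leqNgt ik.
have := Pmax alpha g k (lexx _) ga gk; move: mz => /=; rewrite (asboolT sk) E => ->.
by rewrite leNgt zg.
Qed.

(** * Sparse sets, fans, and functions on barriers of smaller rank *)

(** Stated for all sufficiently sparse [H], so that one [H] chosen later can work against many [f]
    at once, by dominating their [phi]. *)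
Definition misses (C : set {fset nat}) (r : {fset nat}) (N : set nat)
    (f : {fset nat} -> {fset nat}) (t : {fset nat}) (phi : nat -> nat) n0 :=
  forall H : set nat, (forall i, H i -> n0 <= i) -> sparse phi H ->
  forall s, cone C r N s -> uniform_barrier (f s) -> starts t (f s) ->
  (forall i, i \in f s -> i \notin t -> H i) -> False.

(* The first element k of f s beyond t may be assumed to tend to infinity. Once k
   is known, only finitely many proper successors r' of r can lie below s, and
   the induction hypothesis applies to each r' and t, k because urank (k |` t)
   is still at least rho r > rho r'. *)
Lemma sparse_misses C rho (f : {fset nat} -> {fset nat}) :
  barrier_on [set: nat] C -> rank_drops C rho ->
  forall r t N0, tree C r -> (rho r < urank t)%O -> cofinal N0 ->
  exists N phi n0, [/\ cofinal N, N `<=` N0 & misses C r N f t phi n0].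
Proof.
move=> bC drop r.
have [a] : exists a, rho r = a by exists (rho r).
elim/omega1_ind: a r => a IH r ra t N0 Tr rt cN0.
pose next s k := [/\ k \in f s, k \notin t, starts (k |` t)%fset (f s)
  & forall j, j \in f s -> j \notin (k |` t)%fset -> k < j].
have next_inj s k k' : next s k -> next s k' -> k = k'.
  move=> [fk tk _ kmin] [fk' tk' _ kmin']; apply/eqP; apply: contraT => kk'.
  have := kmin k' fk'; rewrite !inE negb_or tk' andbT eq_sym kk' => /(_ isT) lt1.
  have := kmin' k fk; rewrite !inE negb_or tk andbT kk' => /(_ isT) lt2.
  by have := ltn_trans lt1 lt2; rewrite ltnn.
(* The next element [k] is coded as the isolated point [[fset k]]; with no extra points in [A],
   convergence of [h] means that [k] is eventually constant or tends to infinity, or that eventually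
   there is none. *)
have /choice[h hP] s : exists x : psi,
    forall k, next s k <-> x = inl [fset k]%fset.
  have [[k sk]|ns] := pselect (exists k, next s k); last first.
    by exists (inr None) => k; split=> // sk; case: ns; exists k.
  exists (inl [fset k]%fset) => k'; split=> [/(next_inj _ _ _ sk)->//|[/fsetP/(_ k)]].
  by rewrite !inE eqxx => /esym/eqP <-.
have adD : almost_disjoint (fun=> set0) set0 by move=> ? ? [].
have [|N1 [x [cN1 N10 hx]]] := @cone_subsequence C rho _ _ h bC drop
  _ (psi_subsequences adD) r N0 Tr cN0.
  exact/psi_subbase_bounded/countable_jointly_bounded/countable0.
have [[u xu]|nxu] := pselect (exists u, x = inl u).
  have [|n nP] := hx [set x] _ erefl; first by left; left; exists u; rewrite // xu.
  have [k kP] : exists k, forall m, u = [fset m]%fset -> m <= k.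
    have [[m um]|nm] := pselect (exists m, u = [fset m]%fset); last first.
      by exists 0 => m um; case: nm; exists m.
    exists m => m'; rewrite um => /fsetP/(_ m').
    by rewrite !inE eqxx => /eqP->.
  (* Here the next element can only be the number coded by [u], at most [k]; starting [H] at [k.+1]
     excludes it. *)
  exists (N1 `&` [set i | n <= i]), (fun=> 0), k.+1; split.
  - exact: cofinal_from.
  - by move=> i [/N10].
  - move=> H Hk _ s /nP hs Bfs tfs fsH.
    have ntfs : t <> f s.
      move=> tfs'; move: rt; rewrite tfs' (urank_barrier Bfs).
      by rewrite ltNge descent_ge.
    have [m [fm tm _ mfs mmin]] := starts_step tfs ntfs.
    have /hP hm : next s m by split.
    have := Hk m (fsH m fm tm); rewrite ltnNge kP//.
    by move: hs; rewrite /= hm xu => -[].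
have /choice[nn nnP] k : exists n, forall s, cone C r (N1 `&` [set i | n <= i]) s -> ~ next s k.
  have [||n nP] := hx (~` [set inl [fset k]%fset]).
  - by left; right; exists [fset k]%fset.
  - by move=> /= xk; apply: nxu; exists [fset k]%fset.
  - by exists n => s /nP /= hk /hP.
have /choice[lst lstP] := fsets_below.
(* The finitely many pairs of a next element up to [a] and a node inside [[0, a]], both
   inclusive. *)
pose l a : seq (nat * {fset nat}) := [seq (k, r') | k <- iota 0 a.+1, r' <- lst a.+1].
pose cond k r' := [/\ tree C r', starts r r', r <> r', (forall i, i \in t -> i < k)
  & e (rho r) <= k].
pose W (c : nat * {fset nat}) N := cond c.1 c.2 ->
  exists p : (nat -> nat) * nat, misses C c.2 N f (c.1 |` t)%fset p.1 p.2.
have odW c : open_dense (W c).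
  split=> [N cN|N N' N'N WN /WN[p pP]]; last first.
    by exists p => H H0 Hs s /(cone_sub N'N); exact: pP.
  have [[Tr' rr' nrr' tk ek]|ncond] := pselect (cond c.1 c.2); last by exists N; split.
  have lt_a : (rho c.2 < a)%O by rewrite -ra; exact: drop.
  have lt_k : (rho c.2 < urank (c.1 |` t)%fset)%O.
    rewrite urank_step//; apply: lt_le_trans (drop _ _ Tr Tr' rr' nrr') _.
    case: (dP) => _ _ _ _; apply=> //; exact: urank_le_alpha.
  have [N' [phi [n0 [cN' N'N mN']]]] := IH _ lt_a _ erefl _ _ Tr' lt_k cN.
  by exists N'; split=> // _; exists (phi, n0).
pose Q b (N : set nat) := (forall k, k \in iota 0 b.+1 -> forall j, N j -> nn k <= j) /\
  (forall c, c \in l b -> W c N).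
have [b|N2 [cN2 N21 QN2]] := @fusion Q _ _ (@cofinal_from _ (fset_bound r) cN1).
  apply: open_denseI; last exact: open_dense_seq.
  apply: open_dense_seq => k; split=> [N cN|N N' N'N NP j /N'N]; last exact: NP.
  exists (N `&` [set j | nn k <= j]); split=> [|j []//|j []//].
  exact: cofinal_from.
have /choice[b bP] k : exists b, N2 b /\ k <= b by have [b N2b kb] := cN2 k; exists b.
have /choice[p pP] (c : nat * {fset nat}) : exists p : (nat -> nat) * nat,
    c \in l (b c.1) -> cond c.1 c.2 ->
    misses C c.2 (N2 `&` [set j | b c.1 < j]) f (c.1 |` t)%fset p.1 p.2.
  have [[lc cc]|nc] := pselect (c \in l (b c.1) /\ cond c.1 c.2); last first.
    by exists (fun=> 0, 0) => lc cc; case: nc.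
  have [_ QW] := QN2 _ (proj1 (bP c.1)).
  by have [p pP] := QW _ lc cc; exists p.
(* [phi] bounds the data of all pairs with [k <= m], so beyond [k] a [phi]-sparse [H] is sparse and
   late enough for each pair starting with [k]. *)
have /choice[phi phiP] m : exists v, forall k r', k <= m -> (k, r') \in l (b k) ->
    (p (k, r')).1 m <= v /\ (p (k, r')).2 <= v.
  have [||v vP] := @eventually_seq _ (iota 0 m.+1) (fun k v => forall r',
    (k, r') \in l (b k) -> (p (k, r')).1 m <= v /\ (p (k, r')).2 <= v).
  - move=> k v w vw kv r' /kv[v1 v2].
    by rewrite (leq_trans v1 vw) (leq_trans v2 vw).
  - move=> k _.
    have [||v vP] := @eventually_seq _ (l (b k)) (fun c v =>
      (p c).1 m <= v /\ (p c).2 <= v).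
    + by move=> c v w vw [v1 v2]; rewrite (leq_trans v1 vw) (leq_trans v2 vw).
    + move=> c _; exists (maxn ((p c).1 m) (p c).2).
      by rewrite leq_maxl leq_maxr.
    + by exists v => r'; exact: vP.
  - by exists v => k r' km; apply: vP; rewrite mem_iota add0n ltnS km.
(* Starting [H] at [e (rho r)] ensures that the next element leaves at least [rho r]. *)
exists N2, phi, (e (rho r)); split=> //; first by move=> i /N21[/N10].
move=> H He Hphi s [Cs rs sN] Bfs tfs fsH.
have ntfs : t <> f s.
  by move=> tfs'; move: rt; rewrite tfs' (urank_barrier Bfs) ltNge descent_ge.
have [k [fk tk tltk kfs kmin]] := starts_step tfs ntfs.
have nextk : next s k by [].
have Hk := fsH k fk tk.
have [N2b kb] := bP k.
(* This node extends [r] properly: otherwise the new elements of [s] would all lie beyond [b k],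
   hence at or beyond [nn k], where [k] is no longer the next element. *)
pose r' := [fset i in s | i <= b k]%fset.
have r'E i : i \in r' = (i \in s) && (i <= b k) by rewrite !inE.
have rltb i : i \in r -> i < b k.
  by move=> /fset_boundP ir; apply: leq_trans ir _; have [_] := N21 _ N2b.
have rr' : starts r r'.
  split=> [i /= ir|i j /= ir]; first by rewrite r'E (proj1 rs)// ltnW// rltb.
  by rewrite r'E => /andP[sj _]; exact: (proj2 rs).
have r's : starts r' s.
  split=> [i /=|i j /=]; first by rewrite r'E => /andP[].
  by rewrite !r'E => /andP[_ ib] -> ji; exact: leq_trans ib.
have nrr' : r <> r'.
  move=> E; apply: (nnP k s) nextk; split=> // i si ri.
  have bi : b k < i by move: ri; rewrite E r'E si -ltnNge.
  have N2i := sN i si ri.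
  split; first by have [] := N21 _ N2i.
  have [Qn _] := QN2 _ N2b; apply: (Qn k _ i) => //.
  by rewrite mem_iota add0n ltnS.
have condk : cond k r'.
  split=> //; first by apply: tree_starts r's _; exact: sub_tree.
  exact: He.
have lk : (k, r') \in l (b k).
  apply/allpairsP; exists (k, r'); split; last by [].
    by rewrite mem_iota add0n ltnS.
  by apply: lstP => i; rewrite r'E ltnS => /andP[].
apply: (pP (k, r') lk condk (H `&` [set i | k < i]) _ _ s) => //=.
- move=> i [Hi ki]; have [_ p2] := phiP k k r' (leqnn _) lk.
  exact: leq_trans p2 (Hphi _ _ Hk Hi ki).
- move=> i j [Hi ki] [Hj _] ij; have [p1 _] := phiP i k r' (ltnW ki) lk.
  exact: leq_trans p1 (Hphi _ _ Hi Hj ij).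
- split=> // i si; rewrite r'E si -ltnNge /= => bi.
  split=> //; apply: sN => //; apply/negP => /rltb ib.
  by have := ltn_trans ib bi; rewrite ltnn.
- move=> i fi kti; split; last exact: kmin.
  by apply: fsH => //; move: kti; rewrite !inE negb_or => /andP[].
Qed.

(* As the barrier has exactly one initial segment of H `&` [set i | k <= i] for
   each k in H, a fan contains one set for each minimum. *)
Definition fan (H : set nat) : set {fset nat} :=
  [set s | uniform_barrier s /\ exists k, [/\ k \in s, H k
    & initial_segment [set` s] (H `&` [set i | k <= i])]].

Lemma fan_sub H s i : fan H s -> i \in s -> H i.
Proof. by move=> [_ [k [_ _ [sH _]]]] /sH[]. Qed.

Lemma fan_min H s : fan H s -> exists k,
  [/\ k \in s, H k & forall i, i \in s -> k <= i].
Proof. by move=> [_ [k [sk Hk [sH _]]]]; exists k; split=> // i /sH[]. Qed.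

Lemma fan_inj H s t k : fan H s -> fan H t -> k \in s -> k \in t ->
  (forall i, i \in s -> k <= i) -> (forall i, i \in t -> k <= i) -> s = t.
Proof.
move=> [Bs [m [ms _ sH]]] [Bt [n [nt _ tH]]] sk tk smin tmin.
have E (u : {fset nat}) v : initial_segment [set` u] (H `&` [set i | v <= i]) ->
    v \in u -> k \in u -> (forall i, i \in u -> k <= i) -> v = k.
  move=> [uv _] vu ku umin; apply/eqP; rewrite eqn_leq umin// andbT.
  by have [_] := uv _ ku.
have mk := E s m sH ms sk smin; have nk := E t n tH nt tk tmin.
rewrite mk in sH; rewrite nk in tH.
by case: (initial_segment_total sH tH) => st; [|apply/esym];
  exact: (uniform_barrier_antichain).
Qed.

Lemma fan_bound H : exists g : nat -> nat, forall s k, fan H s -> k \in s ->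
  (forall i, i \in s -> k <= i) -> forall i, i \in s -> i < g k.
Proof.
have /choice[g gP] k : exists b, forall s, fan H s -> k \in s ->
  (forall i, i \in s -> k <= i) -> forall i, i \in s -> i < b.
  have [[s [Fs sk smin]]|ns] := pselect (exists s, [/\ fan H s, k \in s
      & forall i, i \in s -> k <= i]).
    by exists (fset_bound s) => t Ft tk tmin i; rewrite -(fan_inj Fs Ft sk tk smin tmin);
      exact: fset_boundP.
  by exists 0 => s Fs sk smin; case: ns; exists s.
by exists g => s k; exact: gP.
Qed.

Lemma fan_below H n : fset_bounded [set s | fan H s /\ exists2 k, k \in s & k < n].
Proof.
have [g gP] := fan_bound H.
exists (\max_(k < n) g k) => s [Fs [k sk kn]] i si.
have [m [ms Hm smin]] := fan_min Fs.
have mn : m < n := leq_ltn_trans (smin _ sk) kn.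
apply: leq_trans (gP s m Fs ms smin i si) _.
exact: (@leq_bigmax _ (fun k : 'I_n => g k) (Ordinal mn)).
Qed.

Hypothesis za : (z < alpha)%O.

Lemma uniform_barrier_min s : uniform_barrier s ->
  exists2 k, k \in s & forall i, i \in s -> k <= i.
Proof.
move=> [m [ms _ _ _]]; have [|k sk kmin] := @ex_minnP (fun i => i \in s).
  by exists m.
by exists k.
Qed.

Lemma fan_hit H n : cofinal H -> exists s, [/\ fan H s, [set` s] `<=` H
  & forall i, i \in s -> n <= i].
Proof.
move=> cH; have [k Hk nk] := cH n.
have [s Bs sH] := cofinal_barrier (uniform_barrierP za) (@cofinal_from _ k cH).
have [m ms smin] := uniform_barrier_min Bs.
have Fs : fan H s.
  split=> //; exists k; split=> //; apply: (proj2 sH m) => //; first by split=> /=.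
  by have [_] := proj1 sH m ms.
exists s; split=> // [i /(fan_sub Fs)//|i si].
by apply: leq_trans nk _; have [_] := proj1 sH i si.
Qed.

Lemma uniform_barrier_hit M n : cofinal M -> exists s,
  [/\ uniform_barrier s, [set` s] `<=` M `\` `I_n & exists2 k, k \in s & n <= k].
Proof.
move=> cM; have [s Bs sM] := cofinal_barrier (uniform_barrierP za) (cofinal_from n cM).
have [k sk _] := uniform_barrier_min Bs.
exists s; split=> //; last by exists k => //; have [_] := proj1 sM k sk.
by move=> i /(proj1 sM)[Mi /= ni]; split=> //=; apply/negP; rewrite -leqNgt.
Qed.

(** * The construction *)

Definition low_barrier (C : set {fset nat}) : Prop := barrier_on [set: nat] C /\
  exists2 rho, rank_drops C rho & (rho fset0 < alpha)%O.

Lemma low_barrier_subsequence D A C f N : almost_disjoint D A ->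
  jointly_bounded A -> low_barrier C -> cofinal N ->
  exists N' x, [/\ cofinal N', N' `<=` N & psi_cvg D A C N' f x].
Proof.
move=> adD bA [bC [rho drop _]] cN.
have [N' [x [cN' N'N /cone_psi_cvg[x' fx']]]] := cone_subsequence f bC drop
  (@psi_subbase_bounded D _ bA) (psi_subsequences adD) (tree0 bC) cN.
by exists N', x'.
Qed.

(* The stage of a task (C, f, M): a fan on fan_set, and a set inf_set on which
   f converges to lim, together with the data of sparse_misses. *)
Record stage := Stage { fan_set : set nat; inf_set : set nat; lim : psi;
  growth : nat -> nat; start : nat }.

Section Stages.
Variables (task : set nat -> set {fset nat} * ({fset nat} -> {fset nat}) * set nat).
Variable lt : set nat -> set nat -> Prop.
Hypothesis lt_wf : well_founded lt.
Hypothesis lt_tr : forall x y z, lt x y -> lt y z -> lt x z.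
Hypothesis lt_tot : forall x y, x <> y -> lt x y \/ lt y x.
Hypothesis lt_bounded : forall x, jointly_bounded [set y | lt y x].
Variable g : omega1.
Hypothesis (zg : (z < g)%O) (ga : (g < alpha)%O).

Definition task_C x := (task x).1.1.
Definition task_f x := (task x).1.2.
(** The default [setT] lets every index, even one coding a finite set, receive a fan. *)
Definition task_M x : set nat := if pselect (cofinal (task x).2) then (task x).2 else setT.
Definition fans (p : set nat -> stage) x := fan (fan_set (p x)).

(** The fourth clause settles the function of [x] with respect to the earlier fans. The last one
    makes the new fan harmless to every function treated so far, including that of [x], that tends
    to infinity. *)
Definition stage_ok x (p : set nat -> stage) : Prop :=
  [/\ cofinal (fan_set (p x)), fan_set (p x) `<=` task_M x,
      forall y, lt y x -> fset_bounded (fans p y `&` fans p x),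
      low_barrier (task_C x) ->
        [/\ cofinal (inf_set (p x)), inf_set (p x) `<=` task_M x,
            psi_cvg (fans p) [set y | lt y x] (task_C x) (inf_set (p x))
              (inl \o task_f x) (lim (p x))
          & misses (task_C x) fset0 (inf_set (p x)) (task_f x) fset0
              (growth (p x)) (start (p x))]
    & forall y, lt y x \/ y = x -> low_barrier (task_C y) -> lim (p y) = inr None ->
        eventually_on (task_C y) (inf_set (p y)) (fun s => ~ fans p x (task_f y s))].

Lemma lt_irr x : ~ lt x x.
Proof. by elim/(well_founded_ind lt_wf): x => x IH lt_xx; exact: (IH x lt_xx lt_xx). Qed.

Lemma task_M_cofinal x : cofinal (task_M x).
Proof. by rewrite /task_M; case: pselect => //= _ n; exists n. Qed.

Lemma stages_almost_disjoint (A : set (set nat)) p : (forall x, A x -> stage_ok x p) ->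
  almost_disjoint (fans p) A.
Proof.
move=> ok x y Ax Ay nxy; have [xy|yx] := lt_tot nxy.
  by have [_ _ + _ _] := ok y Ay; exact.
by rewrite setIC; have [_ _ + _ _] := ok x Ax; exact.
Qed.

Lemma stage_ok_ext x p q : (forall y, lt y x \/ y = x -> p y = q y) ->
  stage_ok x p -> stage_ok x q.
Proof.
move=> pq [cH HM ad cvg kill]; have xq := pq x (or_intror erefl).
have fq y : lt y x -> fans p y = fans q y by move=> yx; rewrite /fans pq//; left.
split; rewrite -?xq//.
- by move=> y yx; rewrite -(fq y yx) /fans -xq; exact: ad.
- move=> /cvg[cN NM fx mN]; split=> //.
  by apply: psi_cvg_eq fx.
- by move=> y yx; rewrite -(pq y yx) /fans -xq; exact: kill.
Qed.

(** * One stage of the recursion *)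

Lemma inf_set_exists x (D : set nat -> set {fset nat}) (A : set (set nat)) :
  almost_disjoint D A -> jointly_bounded A ->
  exists N l phi n0, low_barrier (task_C x) ->
    [/\ cofinal N, N `<=` task_M x,
        psi_cvg D A (task_C x) N (inl \o task_f x) l
      & misses (task_C x) fset0 N (task_f x) fset0 phi n0].
Proof.
move=> adD bA; have [lx|nlx] := pselect (low_barrier (task_C x)); last first.
  by exists setT, (inr None), (fun=> 0), 0.
have [N1 [l [cN1 N1M N1l]]] :=
  low_barrier_subsequence (inl \o task_f x) adD bA lx (@task_M_cofinal x).
have [bC [rho drop rho_lt]] := lx.
have [|N2 [phi [n0 [cN2 N21 mN2]]]] := sparse_misses (task_f x) bC drop
  (t := fset0) (tree0 bC) _ cN1; first by rewrite urank0.
exists N2, l, phi, n0 => _; split=> //; first by move=> i /N21/N1M.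
exact: psi_cvg_sub N1l.
Qed.

(** A common member with large minimum [k] has a second element [j]. Sparseness of [H'] gives
    [h k <= j], whereas [j < b k] because the fan of [H] has a single set with minimum [k]. *)
Lemma fan_almost_disjoint H H' b h : sparse h H' ->
  (forall s k, fan H s -> k \in s -> (forall i, i \in s -> k <= i) ->
     forall i, i \in s -> i < b k) ->
  eventually_le b h -> fset_bounded (fan H `&` fan H').
Proof.
move=> spH' bP /eventually_leP[n nP].
apply: fset_boundedS (fan_below H' (maxn n (e g))) => s [Hs H's]; split=> //.
have [k [sk H'k smin]] := fan_min H's; exists k => //.
rewrite ltnNge geq_max; apply/negP => /andP[nk ek].
have [j sj kj] := uniform_second zg ga (proj1 H's) ek sk smin.
have := leq_trans (bP s k Hs sk smin j sj) (nP k nk).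
by rewrite ltnNge spH'//; exact: (fan_sub H's).
Qed.

(** Only finitely many sets of the fan have an element below [m], and [f] eventually avoids each.
    The others lie in the tail of [H] from [m] on, which is [phi]-sparse. *)
Lemma misses_fan C N f phi n0 H h : misses C fset0 N f fset0 phi n0 ->
  (forall u, eventually_on C N (fun s => f s <> u)) ->
  sparse h H -> eventually_le phi h -> eventually_on C N (fun s => ~ fan H (f s)).
Proof.
move=> mf fu spH /eventually_leP[n nP]; pose m := maxn n n0.
have [n1 n1P] := eventually_on_bounded (Pr := fun u s => f s <> u) (fan_below H m)
  (fun u _ => fu u).
exists n1 => s Cs Hfs.
have fs_m i : i \in f s -> m <= i.
  move=> fi; rewrite leqNgt; apply/negP => im.
  by apply: (n1P s Cs (f s)) => //; split=> //; exists i.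
apply: (mf (H `&` [set i | m <= i]) _ _ s) => //.
- by move=> i [_]; apply: leq_trans; exact: leq_maxr.
- move=> i j [Hi mi] [Hj _] ij; apply: leq_trans (spH _ _ Hi Hj ij).
  by apply: nP; apply: leq_trans mi; exact: leq_maxl.
- by apply: cone_sub Cs => i [].
- by case: Hfs.
- by move=> i fi _; split; [exact: fan_sub Hfs _|exact: fs_m].
Qed.

(** The stages before [x] are jointly bounded, so a single [h] dominates their growth functions and
    the bounds of their fans; an [h]-sparse [H] then satisfies all requirements together. *)
Lemma stage_step x p : (forall y, lt y x -> stage_ok y p) ->
  exists q, stage_ok x q /\ forall y, lt y x -> q y = p y.
Proof.
move=> ok; pose A := [set y | lt y x].
have bA : jointly_bounded A := lt_bounded x.
have [N [l [phi [n0 NP]]]] := inf_set_exists x (stages_almost_disjoint ok) bA.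
have /choice[b bP] y := fan_bound (fan_set (p y)).
(* The growth function of [x] itself is included, since its function must survive its own fan. *)
pose phis y := if pselect (y = x) then phi else growth (p y).
have [g1 g1P] := jointly_boundedU bA (countable_jointly_bounded (countable1 x)) phis.
have [g2 g2P] := bA b.
pose h n := maxn (g1 n) (g2 n).
have le_h k : eventually_le k g1 \/ eventually_le k g2 -> eventually_le k h.
  case=> /eventually_leP[n nP]; apply/eventually_leP; exists n => m /nP km;
    by rewrite /h leq_max km ?orbT.
have [H [cH HM spH]] := sparse_subset h (@task_M_cofinal x).
pose q y := if pselect (y = x) then Stage H N l phi n0 else p y.
have qx : q x = Stage H N l phi n0 by rewrite /q; case: pselect.
have qy y : lt y x -> q y = p y.
  by rewrite /q; case: pselect => // yx; rewrite {1}yx => /lt_irr.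
have fq y : lt y x -> fans p y = fans q y by move=> yx; rewrite /fans qy.
exists q; split=> //; split; rewrite ?qx//=.
- move=> y yx; rewrite -fq// /fans qx /=.
  by apply: fan_almost_disjoint spH (bP y) _; apply: le_h; right; exact: g2P.
- move=> /NP[cN NM Nl mN]; split=> //; exact: psi_cvg_eq Nl.
- move=> y yx ly limy; rewrite /fans qx /=.
  have [/(_ ly)[_ _ cvgy my] gy] :
      (low_barrier (task_C y) -> [/\ cofinal (inf_set (q y)), inf_set (q y) `<=` task_M y,
        psi_cvg (fans p) [set w | lt w y] (task_C y) (inf_set (q y))
          (inl \o task_f y) (lim (q y))
        & misses (task_C y) fset0 (inf_set (q y)) (task_f y) fset0
           (growth (q y)) (start (q y))]) /\ eventually_le (growth (q y)) g1.
    case: yx => [yx|->]; last first.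
      rewrite qx; split=> //=; have := g1P x (or_intror erefl).
      by rewrite /phis; case: pselect.
    rewrite qy//; split; first by have [_ _ _ + _] := ok y yx.
    have := g1P y (or_introl yx); rewrite /phis; case: pselect => //.
    by move=> yx'; case: (@lt_irr x); rewrite -{1}yx'.
  apply: misses_fan my _ spH _; last by apply: le_h; left.
  move=> u; move: cvgy; rewrite limy => -[/(_ u)[n nP] _].
  by exists n => s /nP /= fu fsu; apply: fu; rewrite fsu.
Qed.

Lemma stages_exist : exists p, forall x, stage_ok x p.
Proof.
apply: (wf_choose (Stage setT setT (inr None) (fun=> 0) 0) lt_wf lt_tr stage_ok_ext).
exact: stage_step.
Qed.

(** * The space built from all stages *)

Variable p : set nat -> stage.
Hypothesis p_ok : forall x, stage_ok x p.
Hypothesis task_onto : forall C f M, exists x, task x = (C, f, M).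

Lemma task_exists C f M : cofinal M ->
  exists x, [/\ task_C x = C, task_f x = f & task_M x = M].
Proof.
move=> cM; have [x xE] := task_onto C f M; exists x.
by rewrite /task_C /task_f /task_M xE; split=> //; case: pselect.
Qed.

(** Fans added at [x] or later can only disturb convergence to infinity, and that is protected by
    the last clause of [stage_ok] at each of these stages. *)
Lemma stage_psi_cvg x : low_barrier (task_C x) ->
  psi_cvg (fans p) setT (task_C x) (inf_set (p x)) (inl \o task_f x) (lim (p x)).
Proof.
move=> lx; have [_ _ _ /(_ lx)[_ _ + _] _] := p_ok x.
case E: (lim (p x)) => [u|[y|]] //= [fu fo]; split=> //; first by case: fo.
move=> y _; have [yx|nyx] := pselect (lt y x); first exact: fo.
have [_ _ _ _ /(_ x _ lx E) kill] := p_ok y.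
have [|n nP] := kill; last by exists n.
have [->|nxy] := pselect (x = y); first by right.
by left; have [|/nyx] := lt_tot nxy.
Qed.

Lemma psi_cvg_congr D A C N f f' x : (forall s, cone C fset0 N s -> f s = f' s) ->
  psi_cvg D A C N f x -> psi_cvg D A C N f' x.
Proof.
move=> ff'; have ev Pr : eventually_on C N (fun s => Pr (f s)) ->
    eventually_on C N (fun s => Pr (f' s)).
  move=> [n nP]; exists n => s Cs; rewrite -ff'; first exact: nP.
  by apply: cone_sub Cs => i [].
case: x => [u|[x|]] /=; first exact: (ev (fun y => y = inl u)).
  move=> [fu [Ax fx]]; split=> [u|]; first exact: (ev (fun y => y <> inl u)).
  by split=> //; exact: (ev (fun y => psi_nbhd D x y)).
move=> [fu fA]; split=> [u|x Ax]; first exact: (ev (fun y => y <> inl u)).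
exact/(ev (fun y => ~ psi_nbhd D x y))/fA.
Qed.

Lemma psi_seq_compact (c : omega1) : (c < alpha)%O -> seq_compact c (psi_space (fans p)).
Proof.
move=> calpha C bC rC f.
have [rho drop rho0] := barrier_has_rank_drops bC rC.
have lC : low_barrier C by split=> //; exists rho; rewrite ?rho0.
suff [N [x [cN fx]]] : exists N x, cofinal N /\ psi_cvg (fans p) setT C N f x.
  exists N; first exact/infinite_cofinal.
  by exists x; exact: psi_cvg_converges fx.
pose fin s := exists u : {fset nat}, f s = inl u.
(* A two-valued function; its convergence on [N0] makes the values of [f] there eventually all
   finite sets or eventually all not. *)
pose d s : psi := if pselect (fin s) then inl fset0 else inr None.
have ad0 A : almost_disjoint (fun=> set0) A by move=> x y _ _ _; exists 0 => s [].
have cT : cofinal [set: nat] by move=> n; exists n.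
have [N0 [l [cN0 _ dl]]] := low_barrier_subsequence d (ad0 set0)
  (countable_jointly_bounded (countable0 _)) lC cT.
have [[n0 n0P]|[n0 n0P]] : eventually_on C N0 fin \/ eventually_on C N0 (fun s => ~ fin s).
- case: l dl => [u|[x|]] /=; [|by move=> [_ []]|].
    move=> [n nP]; left; exists n => s /nP; rewrite /d; case: pselect => //.
  move=> [/(_ fset0)[n nP] _]; right; exists n => s /nP.
  by rewrite /d; case: pselect.
- pose F s : {fset nat} := if f s is inl u then u else fset0.
  have [x [xC xF xM]] := @task_exists C F _ (cofinal_from n0 cN0).
  have lx : low_barrier (task_C x) by rewrite xC.
  have [_ _ _ /(_ lx)[cN NM _ _] _] := p_ok x; rewrite xM in NM.
  have := stage_psi_cvg lx; rewrite {}xC {}xF => Fl.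
  exists (inf_set (p x)), (lim (p x)); split=> //; apply: psi_cvg_congr Fl => s Cs.
  have [u fu] : fin s by apply: n0P; apply: cone_sub Cs.
  by rewrite /= /F fu.
- pose A : set (set nat) := [set x | exists s, f s = inr (Some x)].
  (* Barriers are countable, so only countably many extra points occur as values, and the sets [D x]
     do not matter for them. *)
  have bA : jointly_bounded A.
    pose G s : set nat := if f s is inr (Some x) then x else set0.
    have := jointly_bounded_image G (countable_jointly_bounded (countableP setT)).
    move=> bG h; have [b bP] := bG h; exists b => x [s fs]; apply: bP.
    by exists s => //; rewrite /G fs.
  have [N [l' [cN NN fl]]] := low_barrier_subsequence f (ad0 A) bA lC
    (cofinal_from n0 cN0).
  have nfin s n : cone C fset0 (N `&` [set i | n <= i]) s -> ~ fin s.
    by move=> Cs; apply: n0P; apply: cone_sub Cs => i [/NN].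
  exists N, l'; split=> //.
  case: l' fl => [u//|[x|]] [fu] /= => [[_ [n nP]]|fA].
    by split=> //; split=> //; exists n => s /nP; case: (f s) => // [u []|].
  split=> // x _; have [Ax|nAx] := pselect (A x).
    have [n nP] := fA x Ax; exists n => s Cs; have := nP s Cs; have := nfin s n Cs.
    rewrite /fin; case: (f s) => // u nu _; by case: nu; exists u.
  exists 0 => s Cs; have := nfin s 0 Cs; rewrite /fin.
  case E: (f s) => [u|[y|]] /= nu; last by [].
    by case: nu; exists u.
  by move=> xy; apply: nAx; exists s; rewrite E xy.
Qed.

Lemma psi_not_seq_compact : ~ seq_compact alpha (psi_space (fans p)).
Proof.
have bB := uniform_barrierP za.
move=> /(_ _ bB (uniform_has_rank za) inl)[M /infinite_cofinal cM [x Mx]].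
have sub U : open (U : set (psi_space (fans p))) -> U x -> exists n, forall s,
    uniform_barrier s -> [set` s] `<=` M `\` `I_n -> U (inl s).
  move=> oU Ux; have [n nP] := Mx U oU Ux; exists n => s Bs sM; apply: nP.
  by exists s => //; split=> //; split=> // i /sM[].
case: x Mx sub => [u|[x|]] _ sub.
- have [||n nP] := sub [set inl u]; [|by []|].
    by rewrite psi_openE; split.
  have [s [Bs sM [k sk nk]]] := uniform_barrier_hit (maxn n (fset_bound u)) cM.
  have /= [su] : [set (inl u : psi)] (inl s).
    apply: nP => // i /sM[Mi /negP]; rewrite -leqNgt geq_max => /andP[ni _].
    by split=> //=; apply/negP; rewrite -leqNgt.
  have : k < k.
    by apply: leq_trans (leq_trans (leq_maxr n _) nk); apply: fset_boundP; rewrite -su.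
  by rewrite ltnn.
(* A fan has one set for each minimum, but inside [M] there are members of the barrier with minimum
   [k] and an element beyond any bound; two of them would lie in the same fan. *)
- have [||n nP] := sub (psi_nbhd (fans p) x); [|by []|].
    by rewrite psi_openE; split=> // y /= <-; exists 0 => s [].
  pose m := maxn n (e g).
  have [k Mk mk] := cM m; have [nk ek] : n <= k /\ e g <= k.
    by apply/andP; rewrite -geq_max.
  have start_at b : k < b -> exists s, [/\ fans p x s, k \in s,
      (forall i, i \in s -> k <= i) & exists2 j, j \in s & b <= j].
    move=> kb; have [|s Bs sN] := cofinal_barrier
        (N := [set k] `|` (M `&` [set i | b <= i])) bB.
      by move=> i; have [j Nj ij] := cofinal_from b cM i; exists j => //; right.
    have smin i : i \in s -> k <= i.
      by move=> /(proj1 sN)[->//|[_ /= bi]]; apply: ltnW; exact: leq_trans bi.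
    have [i si _] := uniform_barrier_min Bs.
    have sk : k \in s by apply: (proj2 sN i) => //; [left|exact: smin].
    have [j sj kj] := uniform_second zg ga Bs ek sk smin.
    exists s; split=> //.
      apply: (nP s) => // h sh; have kh := smin h sh.
      split; first by have [->|[]] := proj1 sN h sh.
      by apply/negP; rewrite -leqNgt; exact: leq_trans kh.
    exists j => //; have := proj1 sN j sj; case=> [jk|[]//].
    by move: kj; rewrite jk ltnn.
  have [s [Fs sk smin _]] := start_at _ (ltnSn k).
  have [t [Ft tk tmin [j tj bj]]] := start_at _ (fset_boundP sk).
  have E := fan_inj Fs Ft sk tk smin tmin.
  by have := fset_boundP (t := s) (i := j); rewrite {1}E tj => /(_ isT); rewrite ltnNge bj.
(* Some stage has [M] as its infinite set. The neighbourhood of its extra point has an open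
   complement containing infinity, yet its fan has members inside every tail of [M]. *)
- have [x [_ _ xM]] := @task_exists set0 id _ cM.
  have [cH HM _ _ _] := p_ok x; rewrite {}xM in HM.
  have [||n nP] := sub (~` psi_nbhd (fans p) x); [|by []|].
    rewrite psi_openE; split=> [y /= nxy|_].
      have := stages_almost_disjoint (fun y (_ : setT y) => p_ok y) (x := y) (y := x) I I.
      move=> /(_ (fun e => nxy (esym e))); apply: fset_boundedS => s [Dys nDx].
      by split=> //; apply: contrapT.
    exists [:: x]; split=> [y|]; first by rewrite inE => /eqP yx /= xy; exact: yx.
    exists 0 => s [nD /(_ x)]; rewrite inE eqxx => /(_ isT) nDx.
    by case: nD.
  have [s [Fs sH sn]] := fan_hit n cH.
  apply: (nP s) => //; first by case: Fs.
  by move=> i si; split; [exact/HM/sH|apply/negP; rewrite -leqNgt; exact: sn].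
Qed.

End Stages.

End Uniform.

(** * The gap at a positive ordinal *)

Theorem seq_compact_gap (alpha c0 : omega1) : b_eq_c -> (c0 < alpha)%O ->
  exists X : topologicalType,
    (forall c, (c < alpha)%O -> seq_compact c X) /\ ~ seq_compact alpha X.
Proof.
move=> bc c0a; have [z [e [P dP]]] := descent_exists alpha.
have zP y : (z <= y)%O by case: dP.
have za : (z < alpha)%O := le_lt_trans (zP c0) c0a.
have [[g zg ga]|ng] := pselect (exists2 g, (z < g)%O & (g < alpha)%O).
  have [lt [lt_wf lt_tr lt_tot lt_bounded]] := short_well_order bc.
  have [task task_onto] := task_coding.
  have [p p_ok] := stages_exist dP task lt_wf lt_tr lt_tot lt_bounded zg ga.
  exists (psi_space (fans alpha z P p)); split.
    by move=> c; exact: (psi_seq_compact lt_tot p_ok task_onto).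
  exact: (psi_not_seq_compact dP za lt_tot zg ga p_ok task_onto).
(* Here [alpha] is 1 and the discrete space of naturals works: a barrier of rank 0 has only the
   empty set as a member, so any map on it converges. *)
exists nat; split=> [c ca C bC rC f|].
  have [rho drop rho0] := barrier_has_rank_drops bC rC.
  have cz : c = z.
    by apply/eqP; rewrite eq_le zP andbT leNgt; apply/negP => zc; apply: ng; exists c.
  have C0 s : C s -> s = fset0.
    move=> Cs; apply: contrapT => s0.
    have := drop _ _ (tree0 bC) (sub_tree Cs) (starts0 s) (fun e => s0 (esym e)).
    by rewrite rho0 cz ltNge zP.
  exists setT; first exact: infinite_nat.
  exists (f fset0) => U _ Uf; exists 0 => _ [s [[/C0 -> _] _] <-].
  exact: Uf.
(* In a discrete space [fset_bound] would be eventually constant on the barrier restricted to [M],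
   which has members reaching beyond any number. *)
move=> /(_ _ (uniform_barrierP dP za) (uniform_has_rank dP za) fset_bound).
move=> [M /infinite_cofinal cM [x Mx]].
have [n nP] := Mx [set x] (discrete_open _) erefl.
have [s [Bs sM [k sk]]] := uniform_barrier_hit dP za (maxn n x) cM.
rewrite geq_max => /andP[_ xk].
have : fset_bound s = x.
  apply: nP; exists s => //; split; first by split=> // i /sM[].
  move=> i /sM[Mi /negP]; rewrite -leqNgt geq_max => /andP[ni _].
  by split=> //; apply/negP; rewrite -leqNgt.
by move=> sx; have := fset_boundP sk; rewrite sx ltnNge xk.
Qed.

Local Open Scope order_scope.

Theorem corollary5p15 : b_eq_c ->
  (forall (alpha : omega1) (a : nat -> omega1), (forall n, a n < alpha) ->
     exists X : topologicalType,
       (forall n, seq_compact (a n) X) /\ ~ seq_compact alpha X) /\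
  (forall alpha beta : omega1, alpha < beta ->
     exists X : topologicalType, seq_compact alpha X /\ ~ seq_compact beta X).
Proof.
move=> bc; split=> [alpha a a_lt|alpha beta alpha_lt].
  (* Any [a n] shows that [alpha] is positive, and the space obtained serves all smaller ordinals at
     once. *)
  have [X [compX ncompX]] := seq_compact_gap bc (a_lt 0).
  by exists X; split=> // n; exact: compX.
have [X [compX ncompX]] := seq_compact_gap bc alpha_lt.
by exists X; split=> //; exact: compX.
Qed.
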